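(* Let $\mathfrak{F}$ be a saturated formation containing the class $\mathfrak{U}$ of all finite supersolvable groups, and let $G$ be a finite group. Then $G\in\mathfrak{F}$ if and only if there exists a normal subgroup $H$ of $G$ such that $G/H\in\mathfrak{F}$ and, for any non-cyclic Sylow subgroup $P$ of $H$, every maximal subgroup of $P$ either has a supersolvable supplement in $G$ or satisfies $(\triangle)$ in $G$.
   Context: All groups are finite. A formation is a class $\mathfrak{F}$ of finite groups closed under isomorphism, quotients and such that $G/M,G/N\in\mathfrak{F}$ implies $G/(M\cap N)\in\mathfrak{F}$ for $M,N\unlhd G$; it is saturated if $G/\Phi(G)\in\mathfrak{F}$ implies $G\in\mathfrak{F}$, where $\Phi(G)$ is the Frattini subgroup. A supplement of a subgroup $L$ in $G$ is a subgroup $T\leq G$ with $G=LT$. ''Either ... or'' is inclusive. $(a,b)$ denotes the greatest common divisor of integers $a,b$. Let $L\leq G$. Two subgroups $A,B$ permute if $AB=BA$. - $L$ is S-quasinormal in $G$ if $L$ permutes with every Sylow subgroup of $G$. - $L$ is S-quasinormally embedded in $G$ if every Sylow subgroup of $L$ is a Sylow subgroup of some S-quasinormal subgroup of $G$. - $L$ is $\tau$-quasinormal in $G$ if $L$ permutes with all Sylow $q$-subgroups $Q$ of $G$ (for all primes $q$) such that $(q,|L|)=1$ and $(|L|,|Q^G|)\neq 1$, where $Q^G$ is the normal closure of $Q$ in $G$. - $L_{seG}$ is the subgroup generated by all subgroups of $L$ which are S-quasinormally embedded in $G$; $L_{\tau G}$ is the subgroup generated by all subgroups of $L$ which are $\tau$-quasinormal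 in $G$. - $L$ is weakly S-embedded in $G$ if there is $K\unlhd G$ such that $LK$ is S-quasinormal in $G$ and $L\cap K\leq L_{seG}$. - $L$ is weakly $\tau$-embedded in $G$ if there is $K\unlhd G$ such that $LK$ is S-quasinormal in $G$ and $L\cap K\leq L_{\tau G}$. - $L$ satisfies $(\triangle)$ in $G$ if $L$ is weakly S-embedded or weakly $\tau$-embedded in $G$. *)

(* Defs.v *)
From mathcomp Require Import all_boot all_fingroup all_solvable.
From mathcomp Require Import boolp.

Set Implicit Arguments.
Unset Strict Implicit.
Unset Printing Implicit Defensive.

Local Open Scope group_scope.

(* Closure under isomorphism is imposed in [formation], not here. *)
Definition group_class := forall gT : finGroupType, {group gT} -> Prop.

Definition formation (F : group_class) : Prop :=
  [/\ forall (gT rT : finGroupType) (G : {group gT}) (H : {group rT}),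
        G \isog H -> F gT G -> F rT H,
      forall (gT : finGroupType) (G N : {group gT}),
        N <| G -> F gT G -> F _ (G / N)%G
    & forall (gT : finGroupType) (G M N : {group gT}),
        M <| G -> N <| G -> F _ (G / M)%G -> F _ (G / N)%G ->
        F _ (G / (M :&: N))%G].

Definition saturated (F : group_class) : Prop :=
  forall (gT : finGroupType) (G : {group gT}), F _ (G / 'Phi(G))%G -> F gT G.

(* G has a series 1 = G_0 <= G_1 <= ... <= G_n = G of normal subgroups of G
   whose factors G_(i+1) / G_i are cyclic; s lists G_1, ..., G_n. *)
Definition supersolvable (gT : finGroupType) (G : {group gT}) : Prop :=
  exists2 s : seq {group gT},
    path (fun U V : {group gT} => [&& U \subset V, V <| G & cyclic (V / U)])
         1%G s
    & last 1%G s = G.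

Section Embedding.

Variable gT : finGroupType.
Implicit Types (G H K L P Q S T : {group gT}) (A : {set gT}).

(* The first argument is a set so that this applies directly to a product
   L * K with K normal in G, which is then automatically a subgroup. *)
Definition S_quasinormal A G : Prop :=
  A \subset G /\ forall P, Sylow G P -> commute A (P : {set gT}).

Definition S_quasinormally_embedded L G : Prop :=
  L \subset G /\
  forall P, Sylow L P -> exists2 S : {group gT}, S_quasinormal S G & Sylow S P.

(* << class_support Q G >> is the normal closure Q^G. *)
Definition tau_quasinormal L G : Prop :=
  L \subset G /\
  forall (q : nat) Q,
    prime q -> q.-Sylow(G) Q -> coprime q #|L| ->
    ~~ coprime #|L| #|<<class_support Q G>>| ->
    commute (L : {set gT}) (Q : {set gT}).

Definition se_core L G : {set gT} :=
  <<\bigcup_(A : {group gT} | (A \subset L) &&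
                              `[< S_quasinormally_embedded A G >]) A>>.

Definition tau_core L G : {set gT} :=
  <<\bigcup_(A : {group gT} | (A \subset L) && `[< tau_quasinormal A G >]) A>>.

Definition weakly_S_embedded L G : Prop :=
  exists K : {group gT},
    [/\ K <| G, S_quasinormal (L * K) G & L :&: K \subset se_core L G].

Definition weakly_tau_embedded L G : Prop :=
  exists K : {group gT},
    [/\ K <| G, S_quasinormal (L * K) G & L :&: K \subset tau_core L G].

Definition triangle L G : Prop :=
  weakly_S_embedded L G \/ weakly_tau_embedded L G.

Definition has_supersolvable_supplement L G : Prop :=
  exists T : {group gT}, [/\ T \subset G, L * T = G & supersolvable T].

End Embedding.

(* Main.v *)
Require Import Defs.
From mathcomp Require Import all_boot all_fingroup all_solvable.
From mathcomp Require Import ssralg boolp.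

(** Only one implication has content: if G is in F, take H = 1. Conversely,
    let H be given, and call a maximal subgroup of a Sylow subgroup admissible
    when it has a supersolvable supplement or satisfies (triangle). This
    property is inherited by intermediate subgroups and by suitable quotients.

    Let q be the largest prime divisor of the order of H, and Q a Sylow
    q-subgroup of H. If Q is normal in H, it is normal in G, induction applies
    to G / Q and H / Q, and it remains to treat a normal q-subgroup in the role
    of H ([formation_normal_pgroup]). There one reduces to Q minimal normal and
    chooses a maximal subgroup L of Q that is normal in a Sylow q-subgroup of
    G: either G is itself the supersolvable supplement, or (triangle) makes L
    normalised by all other Sylow subgroups, so that L is trivial and Q has
    prime order. A normal subgroup of prime order is harmless because F is
    saturated and contains the supersolvable groups ([formation_prime_normal]).

    That Q is normal follows by peeling off the smallest primes from
    [admissible_Sylow_p_nilpotent]: if p is the least prime divisor of the order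
    of G and the Sylow p-subgroup P is cyclic or has only admissible maximal
    subgroups, then G has a normal p-complement. A minimal counterexample has
    O_p'(G) = 1, and its proper subgroups containing P are p-nilpotent.

    If O_p(G) is not trivial, G has a unique minimal normal subgroup N, and N
    has a complement M. A maximal subgroup L of P that contains P :&: M cannot
    have a supersolvable supplement, and (triangle) makes L :&: N normal in G,
    so that N is central of order p ([p_nilpotent_of_minnormal]).

    If O_p(G) is trivial, R = O^p(G) lies in every nontrivial normal subgroup,
    and every L with (triangle) contains R :&: P; this is where the two kinds
    of cores are analysed ([embedded_contains_residual],
    [permuting_contains_residual]). If all maximal subgroups of P contain
    R :&: P, Tate's theorem ends the proof. Otherwise there is a supersolvable
    Hall p'-subgroup V. By P. Hall's conjugacy theorem for Sylow towers and the
    Frattini argument, P = (R :&: P) * 'N_P(V), so a maximal subgroup of P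
    containing 'N_P(V) must have a supersolvable supplement; but its Hall
    p'-subgroup is conjugate to V under P, which is impossible.

    Two facts about permuting subgroups are used throughout: an S-quasinormal
    subgroup S contains all q'-elements of S Q for Q a Sylow q-subgroup
    ([p_residual_S_quasinormal]), and Q normalises the intersection of S with a
    normal q'-subgroup as soon as S and Q permute ([comm_normI]). *)

Set Implicit Arguments.
Unset Strict Implicit.
Unset Printing Implicit Defensive.

Local Open Scope group_scope.

(** * O^p(G) and normal p-complements *)

(** This is O^p(G), the least normal subgroup whose quotient is a p-group (see
    [quotient_p_residual_pgroup] and [p_residual_min]); generating it by the
    p'-elements makes it monotone in G and compatible with morphisms. *)
Definition p_residual (gT : finGroupType) (p : nat) (A : {set gT}) : {set gT} :=
  <<[set x in A | p^'.-elt x]>>.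

Canonical p_residual_group gT p A := Eval hnf in [group of @p_residual gT p A].

(** G has a normal p-complement exactly when O^p(G) is a p'-group, the
    complement then being O^p(G) itself; this form makes heredity immediate. *)
Definition p_nilpotent (gT : finGroupType) (p : nat) (A : {set gT}) : bool :=
  p^'.-group (p_residual p A).

Section Resid.
Variables (gT : finGroupType) (p : nat).
Implicit Types G H K N P Q X : {group gT}.

Lemma p_residual_sub G : p_residual p G \subset G.
Proof. by rewrite gen_subG; apply/subsetP=> x; rewrite inE => /andP[]. Qed.

Lemma mem_p_residual G x : x \in G -> p^'.-elt x -> x \in p_residual p G.
Proof. by move=> Gx px; rewrite mem_gen // inE Gx. Qed.

Lemma p_residualS G H : G \subset H -> p_residual p G \subset p_residual p H.
Proof.
move=> /subsetP sGH; rewrite genS //; apply/subsetP=> x.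
by rewrite !inE => /andP[/sGH-> ->].
Qed.

Lemma norm_p_residual G : 'N(G) \subset 'N(p_residual p G).
Proof.
apply/subsetP=> x Nx; apply: (subsetP (norm_gen _)); rewrite inE.
apply/subsetP=> y /imsetP[z]; rewrite !inE => /andP[Gz pz] ->.
by rewrite memJ_norm // Gz p_eltJ.
Qed.

Lemma p_residual_normal G : p_residual p G <| G.
Proof.
by rewrite /normal p_residual_sub (subset_trans (normG G) (norm_p_residual G)).
Qed.

Lemma p_residual_normal_trans G K : K <| G -> p_residual p K <| G.
Proof.
case/andP=> sKG nKG; rewrite /normal (subset_trans (p_residual_sub _) sKG).
exact: subset_trans nKG (norm_p_residual K).
Qed.

Lemma quotient_p_residual_pgroup G : p.-group (G / p_residual p G).
Proof.
apply/pgroupP=> q q_pr /(Cauchy q_pr)[xb]; case/morphimP=> x Nx Gx -> ox.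
apply/idPn => p'q.
have p'x: p^'.-elt (coset (p_residual p G) x) by rewrite /p_elt ox pnatE.
have x1: coset (p_residual p G) x = 1.
  rewrite -(constt_p_elt p'x) -morph_constt //= coset_id //.
  by rewrite mem_p_residual ?p_elt_constt // groupX.
by rewrite /= x1 order1 in ox; rewrite -ox in q_pr.
Qed.

Lemma p_residual_min G N :
  G \subset 'N(N) -> p.-group (G / N) -> p_residual p G \subset N.
Proof.
move=> nNG pGN; rewrite gen_subG; apply/subsetP=> x /setIdP[Gx p'x].
have Nx := subsetP nNG x Gx; apply: coset_idr => //.
apply/eqP; rewrite -order_eq1 -(part_pnat_id (mem_p_elt pGN (mem_quotient N Gx))).
by apply/eqP; apply: part_p'nat; exact: morph_p_elt.
Qed.

Lemma p_residual_mul_Sylow G P : p.-Sylow(G) P -> p_residual p G * P = G.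
Proof.
move=> sylP; have [sPG _ p'i] := and3P sylP.
have nRG := normal_norm (p_residual_normal G).
have nRP := subset_trans sPG nRG.
apply/eqP; rewrite eqEsubset mul_subG ?p_residual_sub //=.
rewrite -quotientSK //.
have sylPR: p.-Sylow(G / p_residual p G) (P / p_residual p G)%G by apply: quotient_pHall.
by rewrite -(pHall_id sylPR (quotient_p_residual_pgroup G)).
Qed.

Lemma p_residual1_pgroup G : p_residual p G = 1 -> p.-group G.
Proof.
by move=> R1; have := quotient_p_residual_pgroup G;
   rewrite R1 -(isog_pgroup _ (quotient1_isog G)).
Qed.

Lemma p_nilpotentS G H : H \subset G -> p_nilpotent p G -> p_nilpotent p H.
Proof. by move=> /p_residualS; apply: pgroupS. Qed.

End Resid.

Section ResidQuotient.
Variables (gT : finGroupType) (p : nat).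
Implicit Types G H K N P Q X : {group gT}.

Lemma morphim_p_residual (rT : finGroupType) (D : {group gT})
    (f : {morphism D >-> rT}) G :
  G \subset D -> p_residual p (f @* G) = f @* p_residual p G.
Proof.
move=> sGD; apply/eqP; rewrite eqEsubset; apply/andP; split.
  rewrite gen_subG; apply/subsetP=> xb /setIdP[/morphimP[x Dx Gx ->] p'x].
  rewrite -(constt_p_elt p'x) -morph_constt // mem_morphim //; first exact: groupX.
  by rewrite mem_p_residual ?p_elt_constt // groupX.
rewrite sub_morphim_pre; last exact: subset_trans (p_residual_sub p G) sGD.
rewrite gen_subG; apply/subsetP=> x /setIdP[Gx p'x]; have Dx := subsetP sGD x Gx.
by rewrite mem_morphpre //= mem_p_residual ?mem_morphim ?morph_p_elt.
Qed.

Lemma quotient_p_residual G N :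
  G \subset 'N(N) -> p_residual p (G / N) = p_residual p G / N.
Proof. exact: morphim_p_residual. Qed.

Lemma p_nilpotent_p'quotient G N :
  N <| G -> p^'.-group N -> p_nilpotent p (G / N) -> p_nilpotent p G.
Proof.
case/andP=> _ nNG p'N; rewrite /p_nilpotent quotient_p_residual // => p'Q.
have nNR := subset_trans (p_residual_sub p G) nNG.
have: p^'.-group (p_residual p G <*> N).
  rewrite -(pquotient_pgroup p'N) ?quotientYidr //.
  by rewrite join_subG nNR normG.
by apply: pgroupS; apply: joing_subl.
Qed.

Lemma p_nilpotent_normal_p' G N :
  G \subset 'N(N) -> p^'.-group N -> p.-group (G / N) -> p_nilpotent p G.
Proof. by move=> nN p'N pQ; apply: pgroupS p'N; apply: p_residual_min. Qed.

(** O^p(G) meets [N1] in a group that embeds in [G / N2], and maps into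
    [G / N1] modulo that intersection. *)
Lemma p_nilpotent_quotientI G N1 N2 :
  N1 <| G -> N2 <| G -> N1 :&: N2 = 1 ->
  p_nilpotent p (G / N1) -> p_nilpotent p (G / N2) -> p_nilpotent p G.
Proof.
move=> /andP[_ nN1] /andP[_ nN2] tiN.
rewrite /p_nilpotent !quotient_p_residual // => p1 p2.
have nRG := p_residual_sub p G.
have nR1 := subset_trans nRG nN1; have nR2 := subset_trans nRG nN2.
set R := p_residual_group p G.
have tiI: (R :&: N1) :&: N2 = 1 by apply/trivgP; rewrite -tiN setSI ?subsetIr.
have p3: p^'.-group (R :&: N1).
  have nI2 : R :&: N1 \subset 'N(N2) by apply: subset_trans nR2; apply: subsetIl.
  have isoI: (R :&: N1)%G \isog (R :&: N1) / N2.
    by apply: quotient_isog => //; rewrite setIC.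
  rewrite (isog_pgroup _ isoI).
  by apply: pgroupS p2; apply: quotientS; apply: subsetIl.
have nI: R \subset 'N(R :&: N1) by apply: normsI (normG _) nR1.
rewrite -(pquotient_pgroup p3 nI).
by have:= second_isog nR1; rewrite setIC => /isog_pgroup->.
Qed.

(** The normal p-complement of K is characteristic in K, hence contained in
    O_p'(G). *)
Lemma normal_p_nilpotent_pgroup G K :
  'O_p^'(G) = 1 -> K <| G -> p_nilpotent p K -> p.-group K.
Proof.
move=> O1 nsKG pK.
apply/p_residual1_pgroup/trivgP; rewrite -O1.
by apply: pcore_max => //; apply: p_residual_normal_trans.
Qed.

End ResidQuotient.

(** * Least prime divisors and Sylow arguments *)

Definition least_prime (gT : finGroupType) (p : nat) (G : {group gT}) : Prop :=
  forall q, prime q -> q %| #|G| -> p <= q.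

Section Misc.
Variable gT : finGroupType.
Implicit Types G H K N P Q X : {group gT}.

Lemma least_primeS (p : nat) G H : H \subset G -> least_prime p G -> least_prime p H.
Proof. by move=> sHG h q q_pr qH; apply: h => //; apply: dvdn_trans (cardSg sHG). Qed.

(** The index of X in G is prime to every prime. *)
Lemma sub_by_Sylow G X :
  (forall q, prime q -> exists2 Q : {group gT}, q.-Sylow(G) Q & Q \subset X) ->
  G \subset X.
Proof.
move=> h; have sYG : X :&: G \subset G by apply: subsetIr.
apply/setIidPr/eqP; rewrite eqEcard sYG /=.
apply: dvdn_leq; rewrite ?cardG_gt0 //; apply/dvdn_partP; rewrite ?cardG_gt0 // => q.
rewrite mem_primes => /and3P[q_pr _ _]; have [Q sQ sQX] := h q q_pr.
by rewrite -(card_Hall sQ) cardSg // subsetI sQX (pHall_sub sQ).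
Qed.

Lemma norm_by_Sylow p G P (A : {set gT}) :
  p.-Sylow(G) P -> P \subset 'N(A) ->
  (forall q Q, prime q -> q != p -> q.-Sylow(G) Q -> Q \subset 'N(A)) ->
  G \subset 'N(A).
Proof.
move=> sylP nP h; apply: (@sub_by_Sylow G 'N(A)%G) => q q_pr.
have [-> | nqp] := eqVneq q p; first by exists P.
by have [Q sylQ] := Sylow_exists q G; exists Q => //; apply: h sylQ.
Qed.

Lemma mem_p'elt (p : nat) X x :
  p^'.-elt x ->
  (forall r (R : {group gT}), prime r -> r != p -> r.-group R ->
     R \subset <[x]> -> R \subset X) ->
  x \in X.
Proof.
move=> p'x sX; rewrite -cycle_subG; apply: sub_by_Sylow => r r_pr.
have [R sylR] := Sylow_exists r <[x]>; have [sRx rR _] := and3P sylR.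
exists R => //; have [rp | ] := eqVneq r p; last by move/sX; apply.
have pR : p.-group R by rewrite -rp.
by rewrite (card1_trivg (pnat_1 pR (pgroupS sRx p'x))) sub1G.
Qed.

(** [N / 'C_N(D)] embeds in Aut(D), whose order is a power of p times p - 1:
    the first factor is excluded by hypothesis and the second has no prime
    divisor as large as p. *)
Lemma norm_cent_cyclic_pgroup (p : nat) (D N : {group gT}) :
  prime p -> p.-group D -> cyclic D -> N \subset 'N(D) ->
  least_prime p N -> p^'.-nat #|N : 'C_N(D)| ->
  N \subset 'C(D).
Proof.
move=> p_pr pD cycD nDN minp p'i.
suff : #|N : 'C_N(D)| == 1%N by rewrite indexg_eq1 subsetI subxx.
have [-> | ntD] := eqVneq (D : {set gT}) 1.
  by rewrite cent1T setIT indexgg.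
have [_ _ [m oD]] := pgroup_pdiv pD ntD.
have di : #|N : 'C_N(D)| %| p.-1 * p ^ m.+1.-1.
  have nCN : N \subset 'N('C_N(D)) by rewrite normsI ?normG // norms_cent.
  rewrite -totient_pfactor // -oD -card_Aut_cyclic //.
  rewrite -(card_quotient nCN) /= -(ker_conj_aut D).
  by rewrite (card_isog (first_isog_loc _ _)) // cardSg ?Aut_conj_aut.
rewrite Gauss_dvdl in di; last first.
  by rewrite coprime_sym coprimeXl // prime_coprime // -p'natE.
have p1_gt0: 0 < p.-1 by case: (p) p_pr => [|[|]].
apply/eqP/(@pnat_1 \pi(#|N : 'C_N(D)|) _ (pnat_pi (indexg_gt0 _ _))).
apply/pnatP => // q q_pr qi; exfalso.
have le_q := dvdn_leq p1_gt0 (dvdn_trans qi di).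
have le_p : p <= q by apply: minp => //; apply: dvdn_trans qi (dvdn_indexg _ _).
by have := leq_trans le_p le_q; rewrite leqNgt ltn_predL prime_gt0.
Qed.

Lemma cent_prime_order (p : nat) N Q :
  prime p -> #|N| = p -> Q \subset 'N(N) -> least_prime p Q -> Q \subset 'C(N).
Proof.
move=> p_pr oN nNQ minp; apply: (norm_cent_cyclic_pgroup p_pr) => //.
- by rewrite /pgroup oN pnat_id.
- by rewrite prime_cyclic ?oN.
rewrite -card_quotient; first by apply: p'group_quotient_cent_prime; rewrite ?oN.
by rewrite normsI ?normG // norms_cent.
Qed.

End Misc.

(** * Permutable subgroups *)

Section Permuting.
Variable gT : finGroupType.
Implicit Types G H K L N P Q S X Y A B : {group gT}.

Lemma pnat_index_comm q S Q :
  commute (S : {set gT}) Q -> q.-group Q -> q.-nat #|S <*> Q : S|.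
Proof.
move=> cSQ qQ; rewrite comm_joingE // indexMg.
by apply: pnat_dvd qQ; apply: dvdn_indexg.
Qed.

(** The index of S in [X :&: Y] divides two coprime numbers. *)
Lemma setI_coprime_index (pi : nat_pred) S X Y :
  S \subset X -> S \subset Y -> pi.-nat #|X : S| -> pi^'.-nat #|Y : S| ->
  X :&: Y \subset S.
Proof.
move=> sSX sSY piX piY; have sSI: S \subset X :&: Y by rewrite subsetI sSX.
rewrite -indexg_eq1; apply/eqP; apply: (pnat_1 (pi := pi)).
  by apply: pnat_dvd piX; rewrite indexSg ?subsetIl.
by apply: pnat_dvd piY; rewrite indexSg ?subsetIr.
Qed.

(** In the group SQ, of q-power index over S, the q'-group N can only meet it
    inside S; so [S :&: N] is the trace of N on SQ, which Q normalises. *)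
Lemma comm_normI q S Q N :
  commute (S : {set gT}) Q -> q.-group Q -> q^'.-group N ->
  S \subset 'N(N) -> Q \subset 'N(N) -> Q \subset 'N(S :&: N).
Proof.
move=> cSQ qQ q'N nNS nNQ; set Y := S <*> Q.
have nNY : Y \subset 'N(N) by rewrite join_subG nNS.
have sI : Y :&: (N <*> S) \subset S.
  apply: setI_coprime_index (joing_subl S Q) (joing_subr N S) (pnat_index_comm cSQ qQ) _.
  rewrite /= joingC norm_joinEl // indexMg; apply: pnat_dvd q'N; exact: dvdn_indexg.
have -> : S :&: N = Y :&: N.
  apply/eqP; rewrite eqEsubset setSI ?joing_subl //= subsetI subsetIr andbT.
  by apply: subset_trans sI; rewrite setIS ?joing_subl.
by apply: (subset_trans (joing_subr S Q)); rewrite normsI ?normG.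
Qed.

(** The elements b of the generated group with Qb contained in BQ form a
    submonoid, hence a subgroup, that contains all generators. This turns the
    cores of the two embedding conditions into permuting subgroups. *)
Lemma comm_gen_bigcup (P : pred {group gT}) Q :
  (forall A, P A -> commute (A : {set gT}) Q) ->
  commute <<\bigcup_(A : {group gT} | P A) A>> (Q : {set gT}).
Proof.
move=> cQ; set B := <<_>>.
have gZ: group_set [set b in B | Q :* b \subset B * Q].
  apply/group_setP; split=> [|b c].
    by rewrite inE group1 mulg1 mulG_subr.
  rewrite !inE => /andP[Bb sb] /andP[Bc sc]; rewrite groupM //= rcosetM.
  have: Q :* b :* c \subset (B * Q) :* c by rewrite mulSg.
  move/subset_trans; apply.
  rewrite -mulgA; apply: (subset_trans (mulgS B sc)).
  by rewrite mulgA mulGid.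
have sBZ: B \subset Group gZ.
  rewrite gen_subG; apply/bigcupsP=> A PA; apply/subsetP=> a Aa.
  have sAB: A \subset B by apply: sub_gen; apply: bigcup_sup.
  rewrite inE (subsetP sAB) //=; apply: (@subset_trans _ _ (Q * A)).
    by rewrite mulgS ?sub1set.
  by rewrite -cQ // mulSg.
have sQB: Q * B \subset B * Q.
  apply/subsetP=> _ /mulsgP[x b Qx Bb ->].
  have:= subsetP sBZ b Bb; rewrite inE => /andP[_ /subsetP]; apply.
  by apply: mem_mulg; rewrite ?set11.
apply/eqP; rewrite eq_sym eqEcard sQB /=.
by rewrite -[#|Q * B|]card_invg invMg !invGid leqnn.
Qed.

Lemma comm_joing A B Q :
  commute (A : {set gT}) Q -> commute (B : {set gT}) Q ->
  commute (A <*> B) (Q : {set gT}).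
Proof.
move=> cA cB.
have -> : A <*> B = <<\bigcup_(C : {group gT} | (C == A) || (C == B)) C>>.
  congr <<_>>; apply/eqP; rewrite eqEsubset; apply/andP; split.
    by rewrite subUset (bigcup_sup A) ?eqxx // (bigcup_sup B) ?eqxx ?orbT.
  by apply/bigcupsP=> C /orP[] /eqP->; rewrite ?subsetUl ?subsetUr.
by apply: comm_gen_bigcup => C /orP[] /eqP->.
Qed.

Lemma quotient_Sylow_lift q G N (Qb : {group coset_of N}) :
  G \subset 'N(N) -> prime q -> q.-Sylow(G / N) Qb ->
  exists2 Q : {group gT}, q.-Sylow(G) Q & Qb :=: Q / N.
Proof.
move=> nNG q_pr sylQb; have [Q sylQ] := Sylow_exists q G.
have nNQ := subset_trans (pHall_sub sylQ) nNG.
have [_ /morphimP[x Nx Gx ->] ->] := Sylow_trans (quotient_pHall nNQ sylQ) sylQb.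
by exists (Q :^ x)%G; rewrite ?pHallJ //= quotientJ.
Qed.

End Permuting.

Section SQuasinormal.
Variable gT : finGroupType.
Implicit Types G H K L N P Q S X Y A B : {group gT}.

Lemma S_quasinormalP G S q Q :
  S_quasinormal S G -> prime q -> q.-Sylow(G) Q -> commute (S : {set gT}) Q.
Proof. by case=> _ cS q_pr /p_Sylow; apply: cS. Qed.

(** If x is an r-element of SQ with r different from q, and R is a Sylow
    r-subgroup containing it, then x lies in the intersection of SQ and SR,
    where S has index both a power of q and a power of r. *)
Lemma p_residual_S_quasinormal G S q Q :
  S_quasinormal S G -> prime q -> q.-Sylow(G) Q -> p_residual q (S <*> Q) \subset S.
Proof.
move=> qnS q_pr sylQ; have cSQ := S_quasinormalP qnS q_pr sylQ.
have [sSG _] := qnS; have [sQG qQ _] := and3P sylQ.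
rewrite gen_subG; apply/subsetP=> x /setIdP[SQx q'x].
have sXG : <[x]> \subset G.
  by rewrite cycle_subG; apply: subsetP SQx; rewrite join_subG sSG.
apply: (mem_p'elt q'x) => r R r_pr nrq rR sRX.
have [R1 sylR1 sRR1] := Sylow_superset (subset_trans sRX sXG) rR.
have cSR := S_quasinormalP qnS r_pr sylR1.
apply: subset_trans (setI_coprime_index (joing_subl S Q) (joing_subl S R1)
   (pnat_index_comm cSQ qQ) _).
  rewrite subsetI (subset_trans sRX) ?cycle_subG //.
  exact: subset_trans sRR1 (joing_subr S R1).
by apply: pi_p'nat (pnat_index_comm cSR (pHall_pgroup sylR1)) _; rewrite !inE eq_sym.
Qed.

(** With Y the trace of SQ on X, O^q(Y) lies in S, and Y is the product of
    O^q(Y) and its Sylow q-subgroup. *)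
Lemma S_quasinormalI G S X :
  S_quasinormal S G -> X \subset G -> S_quasinormal (S :&: X) X.
Proof.
move=> qnS sXG; split=> [|Q0]; first exact: subsetIr.
case/SylowP=> q q_pr sylQ0; have [sQ0X qQ0 _] := and3P sylQ0.
have [Q sylQ sQ0Q] := Sylow_superset (subset_trans sQ0X sXG) qQ0.
pose Y := ((S <*> Q) :&: X)%G.
have sQ0Y: Q0 \subset Y by rewrite subsetI sQ0X (subset_trans sQ0Q) ?joing_subr.
have sylY : q.-Sylow(Y) Q0 by apply: pHall_subl sylQ0; rewrite ?subsetIr.
suffices defY : (S :&: X) * Q0 = Y.
  by apply/comm_group_setP; rewrite defY groupP.
apply/eqP; rewrite eqEsubset mul_subG ?setSI ?joing_subl //=.
rewrite -[(_ :&: X)]/(gval Y) -{1}(p_residual_mul_Sylow sylY) mulSg //.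
have sRS : p_residual q Y \subset S.
  apply: subset_trans (p_residual_S_quasinormal qnS q_pr sylQ).
  by apply: p_residualS; apply: subsetIl.
by rewrite subsetI sRS (subset_trans (p_residual_sub q Y)) ?subsetIr.
Qed.

Lemma S_quasinormal_quotient G N (A : {set gT}) :
  G \subset 'N(N) -> S_quasinormal A G -> S_quasinormal (A / N) (G / N).
Proof.
move=> nNG [sAG cA]; split=> [|Qb]; first exact: quotientS.
case/SylowP=> q q_pr /(quotient_Sylow_lift nNG q_pr)[Q sylQ ->].
have nNQ := subset_trans (pHall_sub sylQ) nNG.
have nNA := subset_trans sAG nNG.
by rewrite /commute -!quotientMl // cA // (p_Sylow sylQ).
Qed.

(** S permutes with each Sylow p-subgroup P, and SP is then a p-group, so S
    lies in P. *)
Lemma S_quasinormal_pgroup G S p :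
  prime p -> p.-group S -> S_quasinormal S G -> S \subset 'O_p(G).
Proof.
move=> p_pr pS qnS; apply/bigcapsP=> P; rewrite max_pgroup_Sylow => sylP.
have cSP := S_quasinormalP qnS p_pr sylP.
rewrite -(sub_pHall sylP _ (joing_subr S P)) ?joing_subl //.
  by rewrite /= comm_joingE // pgroupM pS (pHall_pgroup sylP).
by rewrite join_subG (pHall_sub sylP); case: qnS => ->.
Qed.

Lemma S_quasinormal1 G : S_quasinormal 1 G.
Proof. by split=> [|P _]; [apply: sub1G | rewrite /commute mulg1 mul1g]. Qed.

Lemma S_quasinormal_normI G N S Q (q p : nat) :
  N <| G -> p.-group N -> S_quasinormal S G -> prime q -> q \in p^' ->
  q.-Sylow(G) Q -> Q \subset 'N(S :&: N).
Proof.
move=> /andP[_ nNG] pN qnS q_pr q'p sylQ; have [sSG _] := qnS.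
apply: (comm_normI (q := q)); rewrite ?(pHall_pgroup sylQ) //.
- exact: S_quasinormalP sylQ.
- exact: pi_p'group pN q'p.
- exact: subset_trans sSG nNG.
exact: subset_trans (pHall_sub sylQ) nNG.
Qed.

(** For a p-group the only Sylow subgroups are itself and the trivial group,
    so a single S-quasinormal overgroup has to be produced. *)
Lemma S_embedded_pgroup G A p :
  prime p -> p.-group A ->
  S_quasinormally_embedded A G <->
  A \subset G /\ exists2 S : {group gT}, S_quasinormal S G & p.-Sylow(S) A.
Proof.
move=> p_pr pA; split=> [[sAG hA] | [sAG [S qnS sylA]]]; split=> //.
  have [|S qnS sylS] := hA A.
    by apply: (p_Sylow (p := p)); rewrite /pHall subxx pA indexgg.
  have [A1 | ntA] := eqVneq (A : {set gT}) 1.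
    exists 1%G; first exact: S_quasinormal1.
    by rewrite A1 /pHall subxx pgroup1 indexgg.
  exists S => //; have [q q_pr sylq] := SylowP _ _ sylS.
  have [_ pA' _] := pgroup_pdiv pA ntA.
  have /pgroupP/(_ p p_pr pA') := pHall_pgroup sylq.
  by rewrite inE => /eqP->.
move=> P sylP; have [q q_pr sylq] := SylowP _ _ sylP.
have [qp | nqp] := eqVneq q p.
  exists S => //; rewrite qp in sylq.
  by rewrite (pHall_id sylq pA) (p_Sylow sylA).
exists 1%G; first exact: S_quasinormal1.
have qP := pHall_pgroup sylq; have pP := pgroupS (pHall_sub sylq) pA.
suff -> : P :=: 1 by rewrite Sylow1.
apply: card1_trivg; apply: pnat_1 qP _; apply: pi_p'group pP _.
by rewrite !inE.
Qed.

End SQuasinormal.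

(** * Supersolvable groups *)

Definition supersolvable_step (gT : finGroupType) (G U V : {group gT}) :=
  [&& U \subset V, V <| G & cyclic (V / U)].

(** Records along the series that the smaller term of each factor is normal in
    G too, which the isomorphism theorems require. *)
Lemma supersolvable_path_normal (gT : finGroupType) (G U : {group gT}) s :
  U <| G -> path (supersolvable_step G) U s ->
  path (fun U V : {group gT} => supersolvable_step G U V && (U <| G)) U s.
Proof.
elim: s U => //= V s IH U nU /andP[sUV ps]; rewrite sUV nU /=.
by apply: IH => //; case/and3P: sUV.
Qed.

(** A form of cyclicity of a factor that is transported directly by morphisms. *)
Lemma cyclic_quotientP (gT : finGroupType) (U V : {group gT}) :
  U <| V -> reflect (exists2 x, x \in V & V :=: U * <[x]>) (cyclic (V / U)).
Proof.
move=> /andP[sUV nUV]; apply: (iffP cyclicP) => [[xb defV] | [x Vx defV]].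
  have: xb \in V / U by rewrite defV cycle_id.
  case/morphimP=> x Nx Vx def_x; exists x => //.
  have nUx: <[x]> \subset 'N(U) by rewrite cycle_subG.
  have: V / U = <[x]> / U by rewrite quotient_cycle // -def_x.
  move/(congr1 (fun A => coset U @*^-1 A)); rewrite !quotientK //.
  by rewrite mulSGid.
exists (coset U x); have Nx := subsetP nUV x Vx.
by rewrite defV quotientMidl quotient_cycle.
Qed.

Lemma supersolvable_morphim (aT rT : finGroupType) (D : {group aT})
    (f : {morphism D >-> rT}) (G : {group aT}) :
  G \subset D -> supersolvable G -> supersolvable (f @* G)%G.
Proof.
move=> sGD [s ps ls]; pose h (U : {group aT}) := (f @* U)%G.
have h1 : h 1%G = 1%G by apply: val_inj; rewrite /= morphim1.
exists (map h s); last by rewrite -h1 last_map ls.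
have:= supersolvable_path_normal (normal1 G) ps; rewrite -h1.
apply: homo_path => U V /andP[/and3P[sUV nV cV] nU].
rewrite morphimS // morphim_normal //=.
have nUV : U <| V by apply: normalS sUV (normal_sub nV) nU.
have sVD := subset_trans (normal_sub nV) sGD.
apply/cyclic_quotientP; first by rewrite morphim_normal.
have [x Vx defV] := cyclic_quotientP nUV cV.
exists (f x); first by rewrite mem_morphim // (subsetP sVD).
have sUD := subset_trans sUV sVD.
by rewrite /= defV morphimMl // morphim_cycle // (subsetP sVD).
Qed.

Lemma supersolvable_quotient (gT : finGroupType) (G N : {group gT}) :
  G \subset 'N(N) -> supersolvable G -> supersolvable (G / N)%G.
Proof. by move=> nNG /(supersolvable_morphim (coset_morphism N) nNG). Qed.

Section Supersolvable.
Variable gT : finGroupType.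
Implicit Types G H K L N P Q R S X Y A B U V : {group gT}.

Lemma supersolvable_conj G x : supersolvable G -> supersolvable (G :^ x)%G.
Proof.
have -> : (G :^ x)%G = (conjgm G x @* G)%G.
  by apply: val_inj; rewrite /= morphim_conj setIid.
exact: supersolvable_morphim.
Qed.

Lemma supersolvable_sub G X : X \subset G -> supersolvable G -> supersolvable X.
Proof.
move=> sXG [s ps ls]; pose h (U : {group gT}) := (U :&: X)%G.
have h1 : h 1%G = 1%G by apply: val_inj; rewrite /= setI1g.
exists (map h s); last first.
  by rewrite -h1 last_map ls; apply: val_inj; rewrite /= (setIidPr sXG).
have:= supersolvable_path_normal (normal1 G) ps; rewrite -{2}h1.
apply: homo_path => U V /andP[/and3P[sUV nV cV] nU].
have nVX : V :&: X <| X by rewrite setIC (normalGI sXG).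
rewrite setSI //= nVX /=.
have nUVX : V :&: X \subset 'N(U).
  exact: subset_trans (subsetIr _ _) (subset_trans sXG (normal_norm nU)).
have:= second_isog nUVX; rewrite [U :&: _]setIA (setIidPl sUV) => /isog_cyclic->.
by apply: cyclicS cV; rewrite quotientS ?subsetIl.
Qed.

Lemma supersolvable_prime_normal G :
  supersolvable G -> G :!=: 1 -> exists2 N : {group gT}, N <| G & prime #|N|.
Proof.
case=> s; elim: s => [|V s IH] /=; first by move=> _ <-; rewrite eqxx.
case/andP=> /and3P[_ nV cV] ps ls ntG.
have [V1 | ntV] := eqVneq (V : {set gT}) 1.
  by have V1' : V = 1%G; [apply: val_inj | apply: IH => //; rewrite -V1'].
have {}cV : cyclic V by rewrite -(isog_cyclic (quotient1_isog V)) in cV.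
have p_pr : prime (pdiv #|V|) by rewrite pdiv_prime // cardG_gt1.
have [x Vx ox] := Cauchy p_pr (pdiv_dvd _).
exists <[x]>%G; last by rewrite -/(order x) ox.
apply: char_normal_trans nV; rewrite sub_cyclic_char //.
by rewrite cycle_subG.
Qed.

End Supersolvable.

(** Modulo a normal subgroup N of prime order the Sylow r-subgroup R is normal
    by induction, so the join NR is normal; R centralises N because no prime
    divisor of its order is less than that of N, so R is characteristic in
    NR. *)
Lemma supersolvable_Sylow_normal (gT : finGroupType) (G R : {group gT}) r :
  supersolvable G -> prime r -> r.-Sylow(G) R ->
  (forall q, prime q -> q %| #|G| -> q <= r) -> R <| G.
Proof.
have [n] := ubnP #|G|; elim: n => // n IHn in gT G R *.
move=> /ltnSE-leGn ssG r_pr sylR maxr; have [sRG rR _] := and3P sylR.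
have [G1 | ntG] := eqVneq (G : {set gT}) 1.
  have R1 : R :=: 1 by apply/trivgP; rewrite -G1.
  by rewrite R1 normal1.
have [N nsNG N_pr] := supersolvable_prime_normal ssG ntG.
have [sNG nNG] := andP nsNG; have nNR := subset_trans sRG nNG.
have ntN: N :!=: 1 by rewrite -cardG_gt1 prime_gt1.
have nRN : R / N <| G / N.
  apply: (IHn _ _ (R / N)%G) => //.
  - by apply: leq_trans leGn; apply: ltn_quotient.
  - exact: supersolvable_quotient.
  - exact: quotient_pHall.
  by move=> q q_pr qG; apply: maxr => //; apply: dvdn_trans qG (dvdn_quotient _ _).
have cRN : R \subset 'C(N).
  apply: (cent_prime_order N_pr) => // q q_pr qR.
  have /eqnP-> : q \in (r : nat_pred) by apply: (pgroupP rR).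
  by apply: maxr => //; apply: cardSg.
have nsNRG : N <*> R <| G by rewrite -quotientYK // -(quotientGK nsNG) cosetpre_normal.
have nsR : R <| N <*> R.
  by rewrite /normal joing_subr join_subG normG andbT cents_norm // centsC.
have sylR' : r.-Sylow(N <*> R) R.
  by apply: pHall_subl sylR; rewrite ?joing_subr ?(normal_sub nsNRG).
by rewrite -(normal_Hall_pcore sylR' nsR) gFnormal_trans.
Qed.

Lemma dvdn_le_max_pdiv (n q : nat) : 0 < n -> prime q -> q %| n -> q <= max_pdiv n.
Proof.
move=> n0 q_pr qn; apply: max_pdiv_max; rewrite mem_primes q_pr n0 //.
Qed.

(** Factor out the normal Sylow subgroup for the largest prime, until that
    prime is p. *)
Lemma supersolvable_p_nilpotent (gT : finGroupType) (G : {group gT}) p :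
  supersolvable G -> least_prime p G -> p_nilpotent p G.
Proof.
have [n] := ubnP #|G|; elim: n => // n IHn in gT G *.
move=> /ltnSE-leGn ssG minp.
have [G1 | ntG] := eqVneq (G : {set gT}) 1.
  by apply: pgroupS (p_residual_sub p G) _; rewrite G1 pgroup1.
have gt1 : 1 < #|G| by rewrite cardG_gt1.
pose r := max_pdiv #|G|; have r_pr: prime r by rewrite max_pdiv_prime.
have maxr q : prime q -> q %| #|G| -> q <= r by apply: dvdn_le_max_pdiv.
have [R sylR] := Sylow_exists r G.
have nsRG := supersolvable_Sylow_normal ssG r_pr sylR maxr.
have [sRG nRG] := andP nsRG; have [_ rR _] := and3P sylR.
have [rp | nrp] := eqVneq r p.
  apply: (p_nilpotent_normal_p' (N := 1)); rewrite ?norms1 ?pgroup1 //.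
  rewrite -(isog_pgroup _ (quotient1_isog G)).
  apply/pgroupP=> q q_pr qG; rewrite inE eqn_leq minp // andbT -rp.
  exact: maxr.
apply: (p_nilpotent_p'quotient nsRG).
  by apply: pi_p'group rR _; rewrite !inE eq_sym.
apply: IHn.
- apply: leq_trans leGn; apply: ltn_quotient => //.
  rewrite -cardG_gt1 (card_Hall sylR) p_part_gt1 mem_primes r_pr cardG_gt0.
  exact: max_pdiv_dvd.
- exact: supersolvable_quotient.
by move=> q q_pr qG; apply: minp => //; apply: dvdn_trans qG (dvdn_quotient _ _).
Qed.

(** A theorem of P. Hall, for Sylow towers of a common type: the Sylow
    subgroups of U and V for their largest prime are conjugate Sylow subgroups
    of G, so one may assume they coincide and pass to the quotient of the
    normaliser. *)
Lemma Hall_supersolvable_conj (gT : finGroupType) (G U V : {group gT}) pi :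
  pi.-Hall(G) U -> pi.-Hall(G) V -> supersolvable U -> supersolvable V ->
  exists2 x, x \in G & V :=: U :^ x.
Proof.
have [n] := ubnP #|U|; elim: n => // n IHn in gT G U V *.
move=> /ltnSE-leUn hU hV ssU ssV.
have oVU : #|V| = #|U| by rewrite (card_Hall hU) (card_Hall hV).
have [U1 | ntU] := eqVneq (U : {set gT}) 1.
  exists 1; rewrite ?group1 // conjsg1 U1; apply/eqP.
  by rewrite trivg_card1 oVU U1 cards1.
have gt1 : 1 < #|U| by rewrite cardG_gt1.
pose r := max_pdiv #|U|; have r_pr: prime r by rewrite max_pdiv_prime.
have rU : r %| #|U| by apply: max_pdiv_dvd.
have maxr q : prime q -> q %| #|U| -> q <= r by apply: dvdn_le_max_pdiv.
have pi_r : r \in pi by apply: (pgroupP (pHall_pgroup hU)).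
have [R sylR] := Sylow_exists r U; have [R' sylR'] := Sylow_exists r V.
have nsRU := supersolvable_Sylow_normal ssU r_pr sylR maxr.
have nsRV : R' <| V by apply: supersolvable_Sylow_normal sylR' _; rewrite ?oVU.
have sylGR := subHall_Sylow hU pi_r sylR.
have sylGR' := subHall_Sylow hV pi_r sylR'.
have [x Gx defR'] := Sylow_trans sylGR sylGR'.
have nsRUx : R' <| (U :^ x)%G by rewrite defR' /= normalJ.
have [_ nRU] := andP nsRUx; have [_ nRV] := andP nsRV.
have [sUG piU _] := and3P hU; have [sVG _ _] := and3P hV.
have hUx : pi.-Hall(G) (U :^ x)%G by rewrite pHallJ.
have sNG : 'N_G(R') \subset G := subsetIl _ _.
have hN (W : {group gT}) : pi.-Hall(G) W -> W \subset 'N(R') ->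
    pi.-Hall('N_G(R') / R') (W / R').
  move=> hW nW; apply: quotient_pHall => //; apply: pHall_subl (hW) => //.
  by rewrite subsetI nW (pHall_sub hW).
have [|||||yb] := IHn _ ('N_G(R') / R')%G (U :^ x / R')%G (V / R')%G.
- apply: (@leq_trans #|U|) => //; rewrite -(cardJg U x).
  apply: ltn_quotient; rewrite ?(normal_sub nsRUx) //.
  rewrite -cardG_gt1 (card_Hall sylR') oVU p_part_gt1 mem_primes r_pr cardG_gt0.
  exact: max_pdiv_dvd.
- exact: hN.
- exact: hN.
- by apply: supersolvable_quotient => //; apply: supersolvable_conj.
- exact: supersolvable_quotient.
case/morphimP=> y Ny /setIP[Gy _] -> /= defV.
exists (x * y); first exact: groupM.
rewrite conjsgM; rewrite -quotientJ // in defV.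
apply: (quotient_inj (H := R')) defV; rewrite //.
by rewrite -(normP Ny) normalJ.
Qed.

(** * Passage to subgroups and quotients *)

Definition admissible (gT : finGroupType) (L G : {group gT}) : Prop :=
  has_supersolvable_supplement L G \/ triangle L G.

(** Which normal subgroups may be factored out: either kind makes
    intersections with a p-subgroup L commute with the passage to the
    quotient. *)
Definition sub_or_p' (gT : finGroupType) (p : nat) (N L : {group gT}) :=
  (N \subset L) || p^'.-group N.

Section Sub.
Variable gT : finGroupType.
Implicit Types G H K L N P Q R S X Y A B U V : {group gT}.

Lemma sub_gen_bigcup (R R' : pred {group gT}) :
  (forall A, R A -> R' A) ->
  <<\bigcup_(A : {group gT} | R A) A>> \subset <<\bigcup_(A : {group gT} | R' A) A>>.
Proof.
by move=> RR'; rewrite genS //; apply/bigcupsP=> A RA; rewrite bigcup_sup // RR'.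
Qed.

(** A Sylow subgroup of X is the trace of one of G, whose normal closure in G
    contains the normal closure in X; both arithmetic conditions on it are
    therefore inherited. *)
Lemma tau_quasinormal_sub G X A :
  A \subset X -> X \subset G -> tau_quasinormal A G -> tau_quasinormal A X.
Proof.
move=> sAX sXG [_ hA]; split=> // q Q0 q_pr sylQ0 coq ncop.
have [sQ0X qQ0 _] := and3P sylQ0.
have [Q sylQ sQ0Q] := Sylow_superset (subset_trans sQ0X sXG) qQ0.
have defQ0 : Q :&: X = Q0.
  apply: (sub_pHall sylQ0); rewrite ?subsetIr ?subsetI ?sQ0Q //.
  by apply: pgroupS (subsetIl _ _) (pHall_pgroup sylQ).
have cAQ : commute (A : {set gT}) Q.
  apply: (hA q) => //; apply: contra ncop => /coprimegS; apply.
  apply: genS; apply/subsetP=> _ /imset2P[x y Qx Xy ->].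
  by apply: memJ_class_support; [apply: (subsetP sQ0Q) | apply: (subsetP sXG)].
apply/comm_group_setP; rewrite -defQ0 group_modl //.
by rewrite -comm_joingE //; apply: groupP.
Qed.

Lemma S_embedded_sub G X A :
  A \subset X -> X \subset G -> S_quasinormally_embedded A G ->
  S_quasinormally_embedded A X.
Proof.
move=> sAX sXG [sAG hA]; split=> // P sylP.
have [S qnS sylS] := hA P sylP.
exists (S :&: X)%G; first exact: (S_quasinormalI qnS).
have [q q_pr sylq] := SylowP _ _ sylS; apply: (p_Sylow (p := q)).
apply: pHall_subl (sylq); rewrite ?subsetIl // subsetI (pHall_sub sylq).
apply: subset_trans sAX.
by have [r _ /pHall_sub] := SylowP _ _ sylP.
Qed.

Lemma se_core_sub G L X :
  L \subset X -> X \subset G -> se_core L G \subset se_core L X.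
Proof.
move=> sLX sXG; apply: sub_gen_bigcup => A /andP[sAL /asboolP hA].
rewrite sAL; apply/asboolP; apply: S_embedded_sub hA => //.
exact: subset_trans sLX.
Qed.

Lemma tau_core_sub G L X :
  L \subset X -> X \subset G -> tau_core L G \subset tau_core L X.
Proof.
move=> sLX sXG; apply: sub_gen_bigcup => A /andP[sAL /asboolP hA].
rewrite sAL; apply/asboolP; apply: tau_quasinormal_sub hA => //.
exact: subset_trans sLX.
Qed.

Lemma S_quasinormal_mul_sub G L X K :
  L \subset X -> X \subset G -> K <| G -> S_quasinormal (L * K) G ->
  S_quasinormal (L * (K :&: X)) X.
Proof.
move=> sLX sXG nsKG qn.
have nKL := subset_trans (subset_trans sLX sXG) (normal_norm nsKG).
rewrite -norm_joinEl // in qn.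
by rewrite group_modl // -norm_joinEl //; apply: (S_quasinormalI qn).
Qed.

Lemma admissible_sub G L X : L \subset X -> X \subset G -> admissible L G -> admissible L X.
Proof.
move=> sLX sXG [[T [sTG defG ssT]] | [] [K [nsKG qn sub]]];
  [left | right; left | right; right].
- exists (T :&: X)%G; split; first exact: subsetIr.
    by rewrite /= group_modl // defG (setIidPr sXG).
  by apply: supersolvable_sub ssT; apply: subsetIl.
- exists (K :&: X)%G; split; first by rewrite /= setIC (normalGI sXG).
    exact: S_quasinormal_mul_sub qn.
  apply: subset_trans (se_core_sub sLX sXG).
  by apply: subset_trans sub; rewrite setIS ?subsetIl.
exists (K :&: X)%G; split; first by rewrite /= setIC (normalGI sXG).
  exact: S_quasinormal_mul_sub qn.
apply: subset_trans (tau_core_sub sLX sXG).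
by apply: subset_trans sub; rewrite setIS ?subsetIl.
Qed.

(** Both alternatives of [sub_or_p'] are inherited by the lift, because it
    contains [P :&: N]. *)
Lemma maximal_quotient_lift (p : nat) P N (Lb : {group coset_of N}) :
  p.-group P -> P \subset 'N(N) -> maximal Lb (P / N) ->
  sub_or_p' p N P ->
  exists L : {group gT}, [/\ maximal L P, Lb :=: L / N & sub_or_p' p N L].
Proof.
move=> pP nNP maxL sc; have pQ : p.-group (P / N) by apply: quotient_pgroup.
have sLP := maxgroupp maxL; have {}sLP := proper_sub sLP.
pose L := (P :&: coset N @*^-1 Lb)%G.
have defL : L / N = Lb by rewrite /= quotient_setIpre (setIidPr sLP).
have sPNL : P :&: N \subset L by rewrite setIS ?sub_cosetpre.
have iL : #|P : L| = p.
  by rewrite -(index_quotient_eq sPNL) ?subsetIl // defL (p_maximal_index pQ).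
have [p_pr _ _] : [/\ prime p, p %| #|P / N| & exists m, #|P / N| = p ^ m.+1]%N.
  apply: pgroup_pdiv pQ _; apply: contraTneq (maxgroupp maxL) => ->.
  by rewrite properE sub1G andbF.
exists L; split=> //.
  apply: p_index_maximal; first exact: subsetIl.
  by rewrite iL.
case/orP: sc => [sNP | co].
  by rewrite /sub_or_p' (subset_trans _ sPNL) // subsetI sNP /=.
by rewrite /sub_or_p' co orbT.
Qed.

End Sub.

Section Quo.
Variables (gT : finGroupType) (p : nat) (G N : {group gT}).
Implicit Types K L P Q R S X Y A B U V : {group gT}.
Hypotheses (p_pr : prime p) (nsNG : N <| G).
Let nNG := normal_norm nsNG.

(** When N is a p'-group, an element of the left-hand side has a
    representative in K that is a p-element of LN; by Sylow's theorem it is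
    conjugate into L under N, which changes neither its membership in K nor
    its coset. *)
Lemma quotientI_sub_or_p' L K :
  p.-group L -> L \subset G -> K <| G -> sub_or_p' p N L ->
  L / N :&: K / N \subset (L :&: K) / N.
Proof.
move=> pL sLG nsKG /orP[sNL | co]; first by rewrite quotientGI.
have nNL := subset_trans sLG nNG.
apply/subsetP=> xb /setIP[/morphimP[l Nl Ll def_l] /morphimP[k Nk Kk def_k]].
have pxb : p.-elt xb by rewrite def_l morph_p_elt // (mem_p_elt pL).
pose k1 := k.`_p; have Kk1 : k1 \in K by rewrite groupX.
have Nk1 : k1 \in 'N(N) by rewrite groupX.
have def_k1 : xb = coset N k1.
  by rewrite morph_constt //= -[coset N k]def_k constt_p_elt.
have LNk1 : k1 \in L <*> N.
  rewrite norm_joinEl //.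
  have: k1 \in coset N @*^-1 (L / N).
    by rewrite mem_morphpre //= -def_k1 def_l mem_quotient.
  by rewrite quotientK // (normC nNL).
have sylL : p.-Sylow(L <*> N) L.
  rewrite /pHall joing_subl pL /= norm_joinEl // indexMg.
  by apply: pnat_dvd co; apply: dvdn_indexg.
have [|x LNx] := Sylow_Jsub sylL _ (p_elt_constt p k); first by rewrite cycle_subG.
rewrite -cycleJ cycle_subG => Lk1.
move: LNx; rewrite /= norm_joinEl // (normC nNL) => /mulsgP[n l1 Nn Ll1 def_x].
have Lk1n : k1 ^ n \in L by rewrite def_x conjgM memJ_norm ?(subsetP (normG L)) in Lk1.
have nNn : n \in 'N(N) by rewrite (subsetP (normG N)).
have -> : xb = coset N (k1 ^ n).
  by rewrite morphJ //= (coset_id Nn) conjg1.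
have nKn : n \in 'N(K).
  by rewrite (subsetP (normal_norm nsKG)) // (subsetP (normal_sub nsNG)).
by rewrite mem_quotient // inE Lk1n memJ_norm.
Qed.

Lemma tau_quasinormal_quotient A :
  p.-group A -> tau_quasinormal A G -> tau_quasinormal (A / N)%G (G / N)%G.
Proof.
move=> pA [sAG hA]; split=> [|q Qb q_pr sylQb coq ncop]; first exact: quotientS.
have [Q sylQ defQb] := quotient_Sylow_lift nNG q_pr sylQb.
have nNA := subset_trans sAG nNG.
have nNQ := subset_trans (pHall_sub sylQ) nNG.
rewrite /commute /= defQb -!quotientMl // (hA q) //.
  have ntA: (A / N)%G :!=: 1.
    by apply: contraNneq ncop => ->; rewrite cards1 coprime1n.
  have [_ pAN _] := pgroup_pdiv (quotient_pgroup N pA) ntA.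
  apply: (@pnat_coprime q); rewrite ?pnat_id //.
  apply: pi_p'group pA _; rewrite !inE.
  by apply: contraTneq coq => ->; rewrite prime_coprime ?negbK.
apply: contra ncop => co; apply: coprime_dvdl (dvdn_quotient A N) _.
apply: coprime_dvdr co; apply: dvdn_trans (dvdn_quotient _ N).
apply: cardSg; rewrite gen_subG; apply/subsetP=> zb /imset2P[xb yb].
rewrite defQb => /morphimP[x Nx Qx def_xb] /morphimP[y Ny Gy def_yb] {zb}->.
rewrite {xb}def_xb {yb}def_yb.
rewrite -morphJ //; apply: mem_morphim; first exact: groupJ.
by apply: mem_gen; apply: memJ_class_support.
Qed.

Lemma S_embedded_quotient A :
  p.-group A -> S_quasinormally_embedded A G ->
  S_quasinormally_embedded (A / N)%G (G / N)%G.
Proof.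
move=> pA /(S_embedded_pgroup _ p_pr pA)[sAG [S qnS sylA]].
apply/(S_embedded_pgroup _ p_pr (quotient_pgroup N pA)).
split; first exact: quotientS.
exists (S / N)%G; first exact: S_quasinormal_quotient.
by apply: quotient_pHall => //; apply: subset_trans nNG.
Qed.

Lemma core_quotient (R : pred {group gT}) (R' : pred {group coset_of N}) :
  (forall A, R A -> A \subset G) -> (forall A, R A -> R' (A / N)%G) ->
  <<\bigcup_(A : {group gT} | R A) A>> / N
    \subset <<\bigcup_(B : {group coset_of N} | R' B) B>>.
Proof.
move=> RG RR'; rewrite quotient_gen; last first.
  by apply/bigcupsP=> A /RG sAG; apply: subset_trans nNG.
rewrite gen_subG; apply/subsetP=> _ /morphimP[x Nx /bigcupP[A RA Ax] ->].
by rewrite mem_gen //; apply/bigcupP; exists (A / N)%G; rewrite ?RR' ?mem_quotient.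
Qed.

Lemma se_core_quotient L :
  p.-group L -> L \subset G -> se_core L G / N \subset se_core (L / N)%G (G / N)%G.
Proof.
move=> pL sLG; apply: core_quotient => A /andP[sAL /asboolP hA].
  exact: subset_trans sLG.
rewrite quotientS //=; apply/asboolP; apply: S_embedded_quotient hA.
exact: pgroupS pL.
Qed.

Lemma tau_core_quotient L :
  p.-group L -> L \subset G -> tau_core L G / N \subset tau_core (L / N)%G (G / N)%G.
Proof.
move=> pL sLG; apply: core_quotient => A /andP[sAL /asboolP hA].
  exact: subset_trans sLG.
rewrite quotientS //=; apply/asboolP; apply: tau_quasinormal_quotient hA.
exact: pgroupS pL.
Qed.

Lemma admissible_quotient L :
  p.-group L -> L \subset G -> sub_or_p' p N L ->
  admissible L G -> admissible (L / N)%G (G / N)%G.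
Proof.
move=> pL sLG sc; have nNL := subset_trans sLG nNG.
case=> [[T [sTG defG ssT]] | [] [K [nsKG qn sub]]];
  [left | right; left | right; right].
- exists (T / N)%G; split; first exact: quotientS.
    by rewrite /= -quotientMl // defG.
  by apply: supersolvable_quotient => //; apply: subset_trans nNG.
- exists (K / N)%G; split; first exact: quotient_normal.
    by rewrite /= -quotientMl //; apply: S_quasinormal_quotient.
  apply: subset_trans (se_core_quotient pL sLG).
  exact: subset_trans (quotientI_sub_or_p' pL sLG nsKG sc) (quotientS _ _).
exists (K / N)%G; split; first exact: quotient_normal.
  by rewrite /= -quotientMl //; apply: S_quasinormal_quotient.
apply: subset_trans (tau_core_quotient pL sLG).
exact: subset_trans (quotientI_sub_or_p' pL sLG nsKG sc) (quotientS _ _).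
Qed.

End Quo.

Definition admissible_Sylow (gT : finGroupType) (P G : {group gT}) : Prop :=
  cyclic P \/ forall L : {group gT}, maximal L P -> admissible L G.

Lemma admissible_Sylow_quotient (gT : finGroupType) (G N P : {group gT}) (p : nat) :
  prime p -> N <| G -> p.-group P -> P \subset G -> sub_or_p' p N P ->
  admissible_Sylow P G -> admissible_Sylow (P / N)%G (G / N)%G.
Proof.
move=> p_pr nsNG pP sPG sc [cP | hP]; [left | right]; first exact: quotient_cyclic.
have nNP := subset_trans sPG (normal_norm nsNG).
move=> Lb maxL; have [L [maxL' defL scL]] := maximal_quotient_lift pP nNP maxL sc.
have sLP := proper_sub (maxgroupp maxL').
have -> : Lb = (L / N)%G by apply: val_inj.
apply: (admissible_quotient p_pr) => //; last exact: hP.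
  exact: pgroupS pP.
exact: subset_trans sPG.
Qed.

Lemma admissible_Sylow_sub (gT : finGroupType) (G X P : {group gT}) :
  P \subset X -> X \subset G -> admissible_Sylow P G -> admissible_Sylow P X.
Proof.
move=> sPX sXG [cP | hP]; [by left | right=> L maxL].
apply: admissible_sub (hP L maxL) => //; apply: subset_trans sPX.
by apply: proper_sub (maxgroupp maxL).
Qed.

(** * Tate's theorem *)

Lemma normal_TI_Sylow_p' (gT : finGroupType) (G K P : {group gT}) (p : nat) :
  prime p -> p.-Sylow(G) P -> K <| G -> P :&: K = 1 -> p^'.-group K.
Proof.
move=> p_pr sylP nsKG tiPK.
have sylK : p.-Sylow(K) (K :&: P) by apply: Sylow_setI_normal sylP.
by rewrite -partG_eq1 -(card_Hall sylK) /= setIC tiPK cards1.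
Qed.

(** Let E be the fibre product of G and f(P) over the common quotient
    [G / O^p(G)] of G and P; it is generated by O^p(G) x 1 and the graph D of f.
    The kernel Z of E -> G is isomorphic to f(Q), where Q is the intersection
    of O^p(G) and P. D is a complement of Z in DZ, which has index prime to p
    in E, so by Gaschutz's theorem Z has a complement C in E. Projecting C,
    which is isomorphic to G, to f(P) gives a homomorphism G -> f(P) that is
    onto because f(Q) consists of nongenerators. It kills O^p(G) as f(P) is a
    p-group, so C contains O^p(G) x 1, and this forces f(Q) = 1. *)
Lemma Tate_ker (gT rT : finGroupType) (G P : {group gT}) (p : nat)
    (f : {morphism P >-> rT}) :
  p.-Sylow(G) P -> 'ker f \subset p_residual p G ->
  p_residual p G :&: P \subset 'Phi(P) -> abelian (f @* (p_residual p G :&: P)) ->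
  p_residual p G :&: P \subset 'ker f.
Proof.
move=> sylP; set R := p_residual_group p G; set Q := (R :&: P)%G => skR sQPhi abQ.
have [sPG pP _] := and3P sylP.
have nsRG : R <| G := p_residual_normal p G.
have [sRG nRG] := andP nsRG; have nRP := subset_trans sPG nRG.
have sylQ : p.-Sylow(R) Q by apply: Sylow_setI_normal sylP.
have nsQP : Q <| P by rewrite /normal subsetIr normsI ?normG.
pose d (x : gT) := (x, f x).
have dM : {in P &, {morph d : x y / x * y}} by move=> x y Px Py; rewrite /d morphM.
pose delta := Morphism dM.
pose A := (@pairg1 gT rT @* R)%G.
pose D := (delta @* P)%G.
pose Z := (@pair1g gT rT @* (f @* Q))%G.
pose E := (A <*> D)%G.
have memA r : r \in R -> (r, 1) \in A by move=> Rr; apply: (mem_morphim _ (in_setT r)).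
have memD x : x \in P -> (x, f x) \in D by move=> Px; apply: (mem_morphim delta Px).
have memZ x : x \in Q -> (1, f x) \in Z.
  move=> Qx; apply: (mem_morphim _ (in_setT _)); apply: mem_morphim => //.
  by case/setIP: Qx.
have inZ z : z \in Z -> exists2 x, x \in Q & z = (1, f x).
  by case/morphimP=> _ _ /morphimP[x Nx Qx ->] ->; exists x.
have nAD : D \subset 'N(A).
  apply/subsetP=> _ /morphimP[x Px _ ->]; rewrite inE.
  apply/subsetP=> _ /imsetP[_ /morphimP[r _ Rr ->] ->].
  have -> : pairg1 rT r ^ d x = (r ^ x, 1).
    by congr (_, _); rewrite /= mul1g mulVg.
  by apply: memA; rewrite memJ_norm // (subsetP nRP).
have memE g y : (g, y) \in E ->
  exists r x, [/\ r \in R, x \in P, g = r * x & y = f x].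
  rewrite /= norm_joinEr // => /mulsgP[_ _ /morphimP[r _ Rr ->] /morphimP[x Px _ ->]].
  by case=> -> ->; exists r, x; rewrite mul1g.
have sDE : D \subset E by apply: joing_subr.
have sAE : A \subset E by apply: joing_subl.
have sZE : Z \subset E.
  apply/subsetP=> _ /inZ[x Qx ->]; have [Rx Px] := setIP Qx.
  have -> : (1, f x) = (x^-1, 1) * (x, f x).
    by congr (_, _); rewrite /= ?mulVg ?mul1g.
  by rewrite groupM ?(subsetP sDE _ (memD x Px)) // (subsetP sAE) // memA ?groupV.
have nsZE : Z <| E.
  rewrite /normal sZE; apply/subsetP=> -[g y] /memE[r [x [Rr Px -> ->]]].
  rewrite inE; apply/subsetP=> _ /imsetP[_ /inZ[z Qz ->] ->].
  have Pz : z \in P by case/setIP: Qz.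
  have -> : (1, f z) ^ (r * x, f x) = (1, f (z ^ x)).
    by congr (_, _); rewrite /= ?mul1g ?mulVg // morphJ.
  by apply: memZ; rewrite memJ_norm // (subsetP (normal_norm nsQP)).
pose F := (Z <*> D)%G.
have sDF : D \subset F by apply: joing_subr.
have sZF : Z \subset F by apply: joing_subl.
have sFE : F \subset E by rewrite join_subG sZE.
have abZ : abelian Z by apply: morphim_abelian.
have coZ : coprime #|Z| #|E : F|.
  have pZ : p.-group Z.
    by rewrite !morphim_pgroup // (pHall_pgroup sylQ).
  apply: (pnat_coprime pZ); have [_ _ p'i] := and3P sylQ.
  have sQA: @pairg1 gT rT @* Q \subset A by apply: morphimS; apply: subsetIl.
  have sQF: @pairg1 gT rT @* Q \subset F.
    apply/subsetP=> _ /morphimP[x _ Qx ->]; have [Rx Px] := setIP Qx.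
    suff: (x, 1) \in F by [].
    have -> : (x, 1) = (1, f x^-1) * (x, f x).
      by congr (_, _); rewrite /= ?mul1g // morphV ?mulVg.
    by rewrite groupM ?(subsetP sDF _ (memD x Px)) // (subsetP sZF) // memZ ?groupV.
  have defE : E = F * A :> {set _}.
    apply/eqP; rewrite eqEsubset mul_subG // andbT /= norm_joinEr //.
    by rewrite -(normC nAD) mulSg.
  have injA : 'injm (@pairg1 gT rT) by apply: injm_pairg1.
  rewrite defE indexMg.
  apply: pnat_dvd p'i; rewrite -(index_injm Q injA (subsetT R)).
  by rewrite -[#|A : F|]indexgI; apply: indexgS; rewrite subsetI sQA.
have spF : [splits F, over Z].
  apply/splitsP; exists D; apply/complP; split.
    apply/trivgP/subsetP=> _ /setIP[/inZ[x _ ->] /morphimP[y Py _ []]].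
    by move=> <- ->; rewrite morph1 set11.
  by rewrite -norm_joinEr // (subset_trans sDE (normal_norm nsZE)).
rewrite -(Gaschutz_split nsZE _ sFE abZ coZ) // in spF.
case/splitsP: spF => C /complP[tiZC defE].
have sCE : C \subset E by rewrite -defE mulG_subr.
pose f1 := [morphism of @fst gT rT].
pose f2 := [morphism of @snd gT rT].
have f2E : f2 @* E = f @* P.
  apply/eqP; rewrite eqEsubset; apply/andP; split; apply/subsetP=> y.
    case/morphimP=> -[g z] _ /memE[r [x [_ Px _ ->]]] ->.
    exact: mem_morphim.
  case/morphimP=> x Nx Px ->; have Dx := subsetP sDE _ (memD x Px).
  exact: (mem_morphim f2 (in_setT (x, f x)) Dx).
have f2C : f2 @* C = f @* P.
  have sub : f2 @* C \subset f @* P by rewrite -f2E morphimS.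
  have : 'Phi(f @* P) <*> (f2 @* C) = f @* P.
    apply/eqP; rewrite eqEsubset join_subG Phi_sub sub /= -{1}f2E -defE.
    rewrite morphimMl ?subsetT //; apply: mul_subG; last exact: joing_subr.
    apply: subset_trans (joing_subl _ _).
    apply/subsetP=> _ /morphimP[_ _ /inZ[x Qx ->] ->] /=.
    have sPhi : f @* 'Phi(P) \subset 'Phi(f @* P) by apply: Frattini_continuous.
    apply: (subsetP sPhi).
    by rewrite mem_morphim ?(subsetP sQPhi) //; case/setIP: Qx.
  by move/Phi_nongen; rewrite genGid.
have f1C : f1 @* C = G.
  have <- : f1 @* E = G.
    apply/eqP; rewrite eqEsubset; apply/andP; split; apply/subsetP=> g.
      case/morphimP=> -[g' z] _ /memE[r [x [Rr Px -> _]]] -> /=.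
      by rewrite groupM ?(subsetP sRG r Rr) ?(subsetP sPG).
    rewrite -(p_residual_mul_Sylow sylP) => /mulsgP[r x Rr Px ->].
    have Erx : (r, 1) * (x, f x) \in E.
      by rewrite groupM ?(subsetP sDE _ (memD x Px)) // (subsetP sAE) // memA.
    exact: (mem_morphim f1 (in_setT _) Erx).
  rewrite -defE morphimMl ?subsetT //.
  suff -> : f1 @* Z = 1 by rewrite mul1g.
  apply/trivgP/subsetP=> _ /morphimP[_ _ /inZ[x _ ->] ->].
  exact: set11.
have sAC : A \subset C.
  apply/subsetP=> _ /morphimP[r _ Rr ->].
  have : r \in f1 @* p_residual p C.
    by rewrite -morphim_p_residual ?subsetT // f1C.
  case/morphimP=> -[g y] _ Cgy /= ->.
  have Cgy' := subsetP (p_residual_sub p C) _ Cgy.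
  suff y1 : y = 1 by rewrite /pairg1 -{1}y1.
  have : f2 (g, y) \in f2 @* p_residual p C by apply: mem_morphim; rewrite ?inE.
  rewrite -morphim_p_residual ?subsetT // f2C.
  have -> : p_residual p (f @* P) = 1.
    apply/trivgP; apply: p_residual_min; first exact: norms1.
    by apply: quotient_pgroup; apply: morphim_pgroup.
  by move/set1P.
apply/subsetP=> q Qq; have [Rq Pq] := setIP Qq; apply/kerP=> //.
have : f q \in f2 @* C by rewrite f2C mem_morphim.
case/morphimP=> -[g y] _ Cgy /= def_y.
have [r [x [Rr Px def_g def_y']]] := memE _ _ (subsetP sCE _ Cgy).
have Rx : x \in R.
  have Pxq : x * q^-1 \in P by rewrite groupM ?groupV.
  rewrite -(mulgKV q x) groupMr // (subsetP skR) //; apply/kerP => //.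
  by rewrite morphM ?morphV ?groupV // def_y def_y' mulgV.
have Cg : (g, 1) \in C by rewrite (subsetP sAC) // memA // def_g groupM.
have : (1, f q) \in Z :&: C.
  rewrite inE memZ //= (_ : (1, f q) = (g, 1)^-1 * (g, y)) ?groupM ?groupV //.
  by congr (_, _); rewrite /= ?mulVg // invg1 mul1g def_y.
by rewrite tiZC => /set1P[].
Qed.

(** Tate's theorem. Applied to reduction modulo the derived subgroup of Q,
    [Tate_ker] shows that Q is perfect, and Q is a p-group. *)
Lemma Tate_p_nilpotent (gT : finGroupType) (G P : {group gT}) (p : nat) :
  prime p -> p.-Sylow(G) P -> P :&: p_residual p G \subset 'Phi(P) -> p_nilpotent p G.
Proof.
move=> p_pr sylP; rewrite setIC => sQPhi; have [sPG pP _] := and3P sylP.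
have nsRG := p_residual_normal p G; have nRP := subset_trans sPG (normal_norm nsRG).
pose Q := (p_residual p G :&: P)%G.
have nQP : P \subset 'N(Q) by rewrite normsI ?normG.
have nQ'P : P \subset 'N(Q^`(1)) by apply: gFnorm_trans.
have sQ'Q : Q^`(1) \subset Q by apply: der_sub.
have [Q1 | ntQ] := eqVneq (Q : {set gT}) 1.
  by apply: (normal_TI_Sylow_p' p_pr sylP nsRG); rewrite setIC.
pose f := restrm_morphism nQ'P (coset_morphism Q^`(1)).
have kerf : 'ker f = Q^`(1).
  by rewrite ker_restrm ker_coset; apply/setIidPr/(subset_trans sQ'Q)/subsetIr.
have := @Tate_ker _ _ G P p f sylP _ sQPhi _.
rewrite kerf (subset_trans sQ'Q) ?subsetIl //.
rewrite morphim_restrm (setIidPr (subsetIr _ _)) sub_der1_abelian // => /(_ isT isT).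
have solQ : solvable Q := pgroup_sol (pgroupS (subsetIr _ _) pP).
move=> sQQ'; have := sol_der1_proper solQ (subxx Q) ntQ.
by rewrite properE sQQ' andbF.
Qed.

(** * Burnside's theorem on cyclic Sylow subgroups *)

(** Burnside's transfer argument: fusion of powers of g inside the cyclic
    group P is trivial, so the transfer G -> P is x |-> x ^+ [#|G : P|] on P,
    and its kernel is a normal p-complement. *)
Lemma cyclic_Sylow_p_nilpotent (gT : finGroupType) (G P : {group gT}) (p : nat) :
  prime p -> p.-Sylow(G) P -> cyclic P ->
  least_prime p G -> p_nilpotent p G.
Proof.
move=> p_pr sylP cycP minp; have [sPG pP p'i] := and3P sylP.
have abP := cyclic_abelian cycP.
have abA : abelian (idm P @* P) by rewrite morphim_idm.
pose V := transfer_morphism G abA.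
have fus g x n :
    g \in P -> x \in G -> (g ^+ n) ^ x^-1 \in P -> (g ^+ n) ^ x^-1 = g ^+ n.
  move=> Pg Gx; set y := g ^+ n => Pyx; have Py : y \in P by apply: groupX.
  have sDP : <[y]> \subset P by rewrite cycle_subG.
  have nDx : x^-1 \in 'N(<[y]>).
    have eqD : <[y ^ x^-1]> = <[y]>.
      apply/eqP; rewrite (eq_subG_cyclic cycP) ?cycle_subG //.
      by rewrite -!orderE orderJ.
    by rewrite inE -cycleJ eqD.
  have sNC : 'N_G(<[y]>) \subset 'C(<[y]>).
    apply: (norm_cent_cyclic_pgroup p_pr (pgroupS sDP pP)); rewrite ?cycle_cyclic ?subsetIr //.
      move=> q q_pr qN; apply: minp => //; apply: dvdn_trans qN (cardSg (subsetIl _ _)).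
    have sPC : P \subset 'C_('N_G(<[y]>))(<[y]>).
      have sPC : P \subset 'C(<[y]>) by rewrite centsC (subset_trans sDP).
      by rewrite !subsetI sPG sPC cents_norm.
    apply: pnat_dvd p'i; apply: dvdn_trans (indexgS _ sPC) _.
    by rewrite indexSg ?subsetIl // subsetI sPG cents_norm // centsC (subset_trans sDP).
  have Cx : x^-1 \in 'C(<[y]>) by apply: (subsetP sNC); rewrite inE groupV Gx.
  by rewrite conjgE invgK -(centP Cx) ?mulKVg ?cycle_id // .
pose fP := FiniteModule.fmod abA.
have idP x : x \in P -> x \in idm P @* P by rewrite morphim_idm.
have V_P g : g \in P -> V g = fP (g ^+ #|G : P|).
  move=> Pg; have Gg := subsetP sPG g Pg.
  have trX := transversalP (rcosets_cycle_partition sPG Gg).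
  rewrite /V /= (transfer_cycle_expansion sPG abA Gg trX).
  rewrite -(sum_index_rcosets_cycle sPG Gg trX).
  rewrite [RHS](FiniteModule.fmodX abA _ (idP g Pg)) -GRing.sumrMnr.
  apply: eq_bigr => x Xx; rewrite -(FiniteModule.fmodX abA _ (idP g Pg)).
  have Gx := subsetP (transversal_sub trX) x Xx.
  rewrite /= fus //.
  have := mulg_exp_card_rcosets P g x.
  by rewrite mem_rcoset conjgE invgK mulgA.
pose K := ('ker V)%G.
have nsKG : K <| G by apply: ker_normal.
have tiPK : P :&: K = 1.
  apply/trivgP/subsetP=> g /setIP[Pg /morphpreP[Gg /set1P Vg]].
  rewrite V_P // in Vg.
  have g1 : g ^+ #|G : P| = 1.
    have := FiniteModule.fmodK abA (idP _ (groupX #|G : P| Pg)).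
    by rewrite -/fP Vg => <-.
  apply/set1P; have co : coprime #[g] #|G : P|.
    by apply: (pnat_coprime (mem_p_elt pP Pg)).
  apply/eqP; rewrite -order_eq1 -dvdn1 -(eqP co) dvdn_gcd dvdnn order_dvdn.
  by rewrite g1 eqxx.
apply: (@pgroupS _ _ K); last exact: (normal_TI_Sylow_p' p_pr sylP nsKG tiPK).
apply: p_residual_min; first exact: normal_norm.
rewrite (isog_pgroup _ (first_isog V)).
pose h := FiniteModule.fmval_morphism abA.
have injh : 'injm h by apply/injmP=> u v _ _; apply: val_inj.
rewrite -(injm_pgroup injh) ?subsetT //; apply: (pgroupS _ pP).
apply/subsetP=> _ /morphimP[u _ _ ->]; have: val u \in idm P @* P := FiniteModule.fmodP u.
by rewrite morphim_idm.
Qed.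

(** * Supplements and their Hall subgroups *)

Section Helpers.
Variables (gT : finGroupType) (p : nat).
Hypothesis p_pr : prime p.
Implicit Types G H K L M N P Q R S T X Y A B U V : {group gT}.

(** Each p'-element is a product of elements of prime power order prime to p. *)
Lemma p_residual_sub_Sylow G X :
  (forall q Q, prime q -> q != p -> q.-Sylow(G) Q -> Q \subset X) ->
  p_residual p G \subset X.
Proof.
move=> h; rewrite gen_subG; apply/subsetP=> x /setIdP[Gx p'x].
apply: (mem_p'elt p'x) => r R r_pr nrp rR sRx.
have sRG : R \subset G by rewrite (subset_trans sRx) ?cycle_subG.
have [Q sylQ sRQ] := Sylow_superset sRG rR.
exact: subset_trans sRQ (h _ _ r_pr nrp sylQ).
Qed.

Lemma p_residual_id G : p_residual p (p_residual p G) = p_residual p G.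
Proof.
apply/eqP; rewrite eqEsubset p_residual_sub gen_subG; apply/subsetP=> x /setIdP[Gx p'x].
by apply: mem_p_residual => //; apply: mem_p_residual.
Qed.

Lemma p_nilpotent_Hall G V : p^'.-Hall(G) V -> V <| G -> p_nilpotent p G.
Proof.
move=> /and3P[_ p'V pi] /andP[_ nVG]; apply: (p_nilpotent_normal_p' nVG p'V).
by rewrite /pgroup card_quotient // -(eq_pnat _ (negnK _)).
Qed.

(** T is p-nilpotent, and its normal p-complement is a Hall p'-subgroup of G
    because T has p-power index. *)
Lemma supplement_Hall G L T :
  p.-group L -> L * T = G -> supersolvable T -> least_prime p G ->
  [/\ p^'.-Hall(G) (p_residual p T), supersolvable (p_residual_group p T) &
      T \subset 'N(p_residual p T)].
Proof.
move=> pL defG ssT minp.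
have sTG : T \subset G by rewrite -defG mulG_subr.
have pnT := supersolvable_p_nilpotent ssT (least_primeS sTG minp).
have nsVT := p_residual_normal p T; split; last exact: normal_norm.
  rewrite /pHall (subset_trans (normal_sub nsVT)) //= [X in X && _]pnT /=.
  rewrite -(Lagrange_index sTG (normal_sub nsVT)) pnatM.
  apply/andP; split.
    have -> : (G : {set gT}) = T * L.
      by rewrite -[LHS]invGid -defG invMg !invGid.
    by rewrite indexMg (eq_pnat _ (negnK _)); apply: pnat_dvd pL; apply: dvdn_indexg.
  rewrite -card_quotient ?normal_norm // (eq_pnat _ (negnK _)).
  exact: quotient_p_residual_pgroup.
exact: supersolvable_sub (normal_sub nsVT) ssT.
Qed.

(** The p-part of T would normalise the conjugate of V, hence lie in a
    P-conjugate of [L], that is in L itself. *)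
Lemma no_supplement_over_normaliser G P L T V x :
  p.-group P -> P \subset G -> maximal L P -> L * T = G ->
  T \subset 'N(V :^ x) -> x \in P ->
  'N_P(V) \subset L -> False.
Proof.
move=> pP sPG maxL defG nT Px sNL.
have [sLP nLP] := andP (p_maximal_normal pP maxL).
have sPT : P :&: T \subset L.
  have -> : (L : {set gT}) = L :^ x by rewrite (normsP nLP).
  rewrite -sub_conjgV; apply: subset_trans sNL.
  rewrite subsetI !sub_conjgV conjGid // subsetIl -normJ /=.
  exact: subset_trans (subsetIr _ _) nT.
have : P \subset L.
  by rewrite -{1}(setIidPr sPG) -defG -group_modl // mul_subG // setIC.
by apply/negP; have := maxgroupp maxL; rewrite properE => /andP[].
Qed.

(** If the order of A were prime to that of the normal closure of Q, this
    closure would lie in O_p'(G) = 1. *)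
Lemma tau_commute G A q Q :
  'O_p^'(G) = 1 -> p.-group A -> tau_quasinormal A G ->
  prime q -> q != p -> q.-Sylow(G) Q -> commute (A : {set gT}) Q.
Proof.
move=> O1 pA [sAG hA] q_pr nqp sylQ.
have [-> | ntA] := eqVneq (A : {set gT}) 1; first by rewrite /commute mulg1 mul1g.
have [-> | ntQ] := eqVneq (Q : {set gT}) 1; first by rewrite /commute mulg1 mul1g.
have [_ pdA _] := pgroup_pdiv pA ntA.
have sQG := pHall_sub sylQ.
apply: (hA q) => //.
  apply: (@pnat_coprime q); rewrite ?pnat_id //.
  by apply: pi_p'group pA _; rewrite !inE.
apply/negP => co; case/negP: ntQ; rewrite -subG1 -O1.
have sQN : Q \subset <<class_support Q G>>.
  by apply: sub_gen; apply: sub_class_support.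
apply: subset_trans sQN _; apply: pcore_max.
  apply/pgroupP=> r r_pr rN; apply/negP; rewrite !inE => /eqP rp.
  have : p %| gcdn #|A| #|<<class_support Q G>>| by rewrite dvdn_gcd pdA -rp.
  by rewrite (eqP co) dvdn1 => /eqP p1; have := p_pr; rewrite p1.
rewrite /normal; apply/andP; split; last exact: norms_gen (class_support_norm _ _).
by rewrite gen_subG class_support_sub_norm // normG.
Qed.

End Helpers.

(** * A minimal normal p-subgroup *)

Section PCore.
Variables (gT : finGroupType) (p : nat) (G P N : {group gT}).
Implicit Types H K L M Q R S T X Y A B U V : {group gT}.
Hypotheses (p_pr : prime p) (sylP : p.-Sylow(G) P).
Hypotheses (minN : minnormal N G) (sNG : N \subset G) (pN : p.-group N).
Hypothesis O1 : 'O_p^'(G) = 1.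

Let nsNG : N <| G.
Proof. by have [/andP[_ nNG] _] := mingroupP minN; apply/andP. Qed.

Let sNP : N \subset P.
Proof. by apply: subset_trans (pcore_sub_Hall sylP); apply: pcore_max. Qed.

Let sPG : P \subset G := pHall_sub sylP.
Let pP : p.-group P := pHall_pgroup sylP.

Lemma minnormal_cases K : K <| G -> K \subset N -> K :=: 1 \/ K :=: N.
Proof.
move=> /andP[_ nKG] sKN; have [K1 | ntK] := eqVneq (K : {set gT}) 1; first by left.
by right; have [_ h] := mingroupP minN; apply: h; rewrite ?ntK.
Qed.

Lemma minnormal_pgroup_abelian : abelian N.
Proof.
have [_ _ /is_abelemP[q _ abN]] := minnormal_solvable minN (subxx N) (pgroup_sol pN).
exact: abelem_abelian abN.
Qed.

(** Let W be the trace of S on N, and x a nontrivial p'-element of S. For h in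
    P, x ^ h is a p'-element of SP, so it lies in S, and so do the commutators
    of N with it. Conjugating by O^p(G), which normalises W, shows that the
    whole normal closure X of x acts trivially on N / W. As x does not
    centralise N, the commutator of X and N is N by minimality. *)
Lemma S_quasinormal_contains_minnormal S :
  p_nilpotent p (G / N) -> S_quasinormal S G -> ~~ p.-group S -> N \subset S.
Proof.
move=> pnGN qnS npS; have [sSG _] := qnS.
have nNG := normal_norm nsNG.
set U := p_residual_group p G; have nsUG : U <| G := p_residual_normal p G.
pose W := (S :&: N)%G.
have sWN : W \subset N by apply: subsetIr.
have nUW : U \subset 'N(W).
  apply: (p_residual_sub_Sylow (X := 'N(W)%G)) => q Q q_pr nqp sylQ.
  by apply: (S_quasinormal_normI nsNG pN qnS q_pr _ sylQ); rewrite !inE.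
(* The centraliser of N in O^p(G) is a normal p-nilpotent subgroup: its
   p-residual D is a central extension of a p'-group by a p-group, which
   splits. *)
have pC : p.-group 'C_U(N).
  have nsCG : 'C_U(N) <| G.
    rewrite /normal subIset ?(normal_sub nsUG) //=.
    by rewrite normsI ?norms_cent ?(normal_norm nsUG).
  apply: (normal_p_nilpotent_pgroup O1 nsCG).
  set C := 'C_U(N)%G; have nNC : C \subset 'N(N) := subset_trans (normal_sub nsCG) nNG.
  have cNC : N \subset 'C(p_residual p C).
    by rewrite centsC (subset_trans (p_residual_sub p C)) ?subsetIr.
  rewrite /p_nilpotent -p_residual_id.
  have : p^'.-group (p_residual p C / N).
    rewrite -(quotient_p_residual p nNC); apply: pgroupS pnGN; apply: p_residualS.
    by apply: quotientS; apply: normal_sub.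
  set D := p_residual_group p C => p'DN.
  have nND : D \subset 'N(N) := subset_trans (p_residual_sub p C) nNC.
  have sylI : p.-Sylow(D) (D :&: N)%G.
    rewrite /pHall subsetIl (pgroupS _ pN) ?subsetIr //= indexgI.
    by rewrite -card_quotient.
  have nsI : D :&: N <| D by rewrite /normal subsetIl normsI ?normG.
  have /splitsP[V /complP[tiIV defD]] := SchurZassenhaus_split (pHall_Hall sylI) nsI.
  have sVD : V \subset D by rewrite -defD mulG_subr.
  have hV : p^'.-Hall(D) V.
    by rewrite -(compl_pHall V sylI); apply/complP; split.
  apply: (p_nilpotent_Hall hV); rewrite /normal sVD -defD mul_subG ?normG //.
  rewrite cents_norm // (subset_trans (subsetIr _ _)) // centsC.
  by apply: subset_trans sVD _; rewrite centsC.
have /exists_inP[x Sx /andP[p'x ntx]] : [exists x in S, p^'.-elt x && (x != 1)].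
  apply: contraR npS => /exists_inPn h.
  apply/p_residual1_pgroup/trivgP; rewrite gen_subG; apply/subsetP=> x /setIdP[Sx p'x].
  by apply/set1P/eqP; have := h x Sx; rewrite p'x /= negbK.
have sSP : p_residual p (S <*> P) \subset S := p_residual_S_quasinormal qnS p_pr sylP.
have S_SP z : z \in S <*> P -> p^'.-elt z -> z \in S.
  by move=> Sz p'z; apply: (subsetP sSP); apply: mem_p_residual.
have sS_SP := subsetP (joing_subl S P); have sP_SP := subsetP (joing_subr S P).
have commW n h : n \in N -> h \in P -> [~ n, x ^ h] \in W.
  move=> Nn Ph; have Pn := subsetP sNP n Nn.
  have SPxh : x ^ h \in S <*> P by apply: groupJ; [exact: sS_SP | exact: sP_SP].
  have Sxh : x ^ h \in S by apply: S_SP; rewrite ?p_eltJ.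
  have Nxh : x ^ h \in 'N(N) by rewrite (subsetP nNG) // (subsetP sSG).
  rewrite inE; apply/andP; split; last by rewrite commgEl groupM ?groupV // memJ_norm.
  rewrite commgEr groupM //; apply: S_SP; rewrite ?p_eltJ ?p_eltV ?p_eltJ //.
  by apply: groupJ; [rewrite groupV | exact: sP_SP].
have defG : P * U = G.
  by rewrite (normC (subset_trans sPG (normal_norm nsUG))) p_residual_mul_Sylow.
pose X := <<class_support [set x] G>>%G.
have sXU : X \subset U.
  rewrite gen_subG class_support_sub_norm ?(normal_norm nsUG) // sub1set.
  by apply: mem_p_residual; rewrite ?(subsetP sSG).
have nXG : G \subset 'N(X) by apply: norms_gen; apply: class_support_norm.
have nWX : X \subset 'N(W) := subset_trans sXU nUW.
have abN : abelian N := minnormal_pgroup_abelian.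
have nWN : N \subset 'N(W) by rewrite sub_abelian_norm.
have sXW : [~: X, N] \subset W.
  rewrite -quotient_cents2 // sub_quotient_pre // gen_subG.
  apply/subsetP=> _ /imset2P[_ g /set1P-> Gg ->].
  have Xxg : x ^ g \in X.
    by apply: mem_gen; apply: memJ_class_support; rewrite ?set11.
  have Nxg := subsetP nWX _ Xxg; rewrite mem_morphpre //=.
  apply/centP=> _ /morphimP[n Wn Nn ->]; apply/commgP.
  rewrite -morphR //= coset_id // -groupV invg_comm.
  move: Gg; rewrite -defG => /mulsgP[h u Ph Uu ->]; rewrite conjgM.
  have Nu : u^-1 \in 'N(N).
    by rewrite groupV (subsetP nNG) // (subsetP (normal_sub nsUG)).
  rewrite -(conjgKV u n) -conjRg memJ_norm ?(subsetP nUW) //.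
  by apply: commW; rewrite ?memJ_norm.
have nsXN : [~: X, N] <| G.
  rewrite /normal normsR // andbT; apply: subset_trans sXW (subset_trans sWN _).
  exact: normal_sub.
have [XN1 | XNN] := minnormal_cases nsXN (subset_trans sXW sWN); last first.
  by rewrite -XNN (subset_trans sXW) ?subsetIl.
case/eqP: ntx; have Xx : x \in X.
  by apply: mem_gen; apply: (subsetP (sub_class_support _ _)); rewrite set11.
have Cx : x \in 'C_U(N).
  by rewrite inE (subsetP sXU) // (subsetP _ x Xx) // (sameP commG1P eqP) XN1.
by apply/eqP; rewrite -order_eq1; apply/eqP/(pnat_1 (mem_p_elt pC Cx) p'x).
Qed.

(** If K = 1 then L itself is S-quasinormal. Otherwise K contains N, so the
    trace of L on N is the trace of the core of L, which permutes with Q: for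
    the first core, its generators are S-quasinormal p-groups by
    [S_quasinormal_contains_minnormal]; for the second, use [tau_commute]. *)
Lemma triangle_normI L :
  p_nilpotent p (G / N) -> (forall K, K <| G -> K :!=: 1 -> N \subset K) ->
  L \subset P -> ~~ (N \subset L) -> triangle L G ->
  forall q Q, prime q -> q != p -> q.-Sylow(G) Q -> Q \subset 'N(L :&: N).
Proof.
move=> pnGN uniqN sLP nNL tri q Q q_pr nqp sylQ.
have nNG := normal_norm nsNG; have sQG := pHall_sub sylQ.
have q'N : q^'.-group N.
  by apply: pi_p'group pN _; rewrite !inE.
have core (R : pred {group gT}) : (forall A, R A -> A \subset L) ->
    (forall A, R A -> commute (A : {set gT}) Q) ->
    L :&: N \subset <<\bigcup_(A : {group gT} | R A) A>> -> Q \subset 'N(L :&: N).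
  move=> RL RQ sLN; pose B := <<\bigcup_(A : {group gT} | R A) A>>%G.
  have sBL : B \subset L by rewrite gen_subG; apply/bigcupsP.
  have -> : L :&: N = B :&: N.
    by apply/eqP; rewrite eqEsubset subsetI sLN subsetIr setSI.
  apply: (comm_normI (q := q)); rewrite ?(pHall_pgroup sylQ) ?(subset_trans sQG) //.
    exact: comm_gen_bigcup.
  by rewrite (subset_trans sBL) // (subset_trans sLP) // (subset_trans sPG).
have K1 K : K :=: 1 -> S_quasinormal (L * K) G -> Q \subset 'N(L :&: N).
  move=> ->; rewrite mulg1 => qnL; apply: (S_quasinormal_normI nsNG pN qnL q_pr _ sylQ).
  by rewrite !inE.
have KN K : K <| G -> K :!=: 1 -> L :&: N \subset L :&: K.
  by move=> nsK ntK; rewrite setIS // uniqN.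
case: tri => -[K [nsKG qn sub]]; have [/K1-> // | ntK] := eqVneq (K : {set gT}) 1.
  apply: core (subset_trans (KN K nsKG ntK) sub) => A /andP[sAL /asboolP seA] //.
  have pA : p.-group A := pgroupS (subset_trans sAL sLP) pP.
  have [sAG [S qnS sylA]] := iffLR (S_embedded_pgroup _ p_pr pA) seA.
  have pS : p.-group S.
    apply: contraR nNL => /(S_quasinormal_contains_minnormal pnGN qnS) sNS.
    apply: subset_trans sAL; apply: subset_trans (pcore_sub_Hall sylA).
    apply: pcore_max => //; apply: normalS sNS _ nsNG.
    by case: qnS.
  have -> : A = S by apply: val_inj; apply: pHall_id sylA pS.
  exact: S_quasinormalP sylQ.
apply: core (subset_trans (KN K nsKG ntK) sub) => A /andP[sAL /asboolP tA] //.
by apply: (tau_commute p_pr O1 _ tA q_pr nqp sylQ); apply: pgroupS (subset_trans sAL sLP) pP.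
Qed.

(** If G is not p-nilpotent then O^p(G) = N V with V a p'-group, and by
    Schur-Zassenhaus and a Frattini argument the normaliser M of V is a complement
    of N. A maximal subgroup L of P over [P :&: M] cannot contain N. It has no
    supersolvable supplement, as Hall p'-subgroups of O^p(G) are conjugate
    under N; so (triangle) makes the trace of L on N normal in G, hence
    trivial. Then N has order p and is central, which is absurd. *)
Lemma p_nilpotent_of_minnormal :
  p_nilpotent p (G / N) -> least_prime p G ->
  (forall K, K <| G -> K :!=: 1 -> N \subset K) ->
  (forall L, maximal L P -> admissible L G) -> p_nilpotent p G.
Proof.
move=> pnGN minp uniqN admP; apply: contraT => npG.
have [ntN nNG] := andP (mingroupp minN).
set R := p_residual_group p G; have nsRG : R <| G := p_residual_normal p G.
have ntR : R :!=: 1 by apply: contraNneq npG => R1; rewrite /p_nilpotent -/R /= R1 pgroup1.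
have sNR := uniqN R nsRG ntR.
have [sRG nRG] := andP nsRG; have nNR := subset_trans sRG nNG.
have sylN : p.-Sylow(R) N.
  rewrite /pHall sNR pN -card_quotient //.
  by move: pnGN; rewrite /p_nilpotent quotient_p_residual.
have nsNR : N <| R by apply/andP.
have /splitsP[V /complP[tiNV defR]] := SchurZassenhaus_split (pHall_Hall sylN) nsNR.
have sVR : V \subset R by rewrite -defR mulG_subr.
have hVR : p^'.-Hall(R) V by rewrite -(compl_pHall V sylN); apply/complP.
have p'V := pHall_pgroup hVR.
have hV : p^'.-Hall(G) V.
  rewrite /pHall (subset_trans sVR sRG) p'V /= (eq_pnat _ (negnK _)).
  rewrite -(Lagrange_index sRG sVR) pnatM -(card_quotient nRG).
  rewrite [X in X && _]quotient_p_residual_pgroup /=.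
  by case/and3P: hVR => _ _; rewrite (eq_pnat _ (negnK _)).
have solN := pgroup_sol pN; have nNV := subset_trans sVR nNR.
have coNV : coprime #|N| #|V| := pnat_coprime pN p'V.
pose M := 'N_G(V)%G.
have defG : M * N = G.
  apply/eqP; rewrite eqEsubset mul_subG ?subsetIl //=; apply/subsetP=> g Gg.
  have sVg : V :^ g \subset N * V by rewrite defR -(normsP nRG g Gg) conjSg.
  have [x Nx defVg] := SchurZassenhaus_trans_sol solN nNV sVg coNV (cardJg V g).
  rewrite -(mulgKV x g) mem_mulg //; have Gx := subsetP sNG x Nx.
  rewrite inE groupM ?groupV //=; apply/normP.
  by rewrite conjsgM defVg conjsgK.
have nNM : ~~ (N \subset M).
  apply: contra npG => sNM; apply: (p_nilpotent_Hall hV).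
  rewrite /normal (subset_trans sVR sRG) -{1}defG mul_subG ?subsetIr //.
  exact: subset_trans sNM (subsetIr _ _).
have tiNM : N :&: M = 1.
  have nsI : N :&: M <| G.
    have nNM' : M \subset 'N(N) := subset_trans (subsetIl G _) nNG.
    have nIM : M \subset 'N(N :&: M) by rewrite normsI ?normG.
    have nIN : N \subset 'N(N :&: M).
      by rewrite sub_abelian_norm ?subsetIl // minnormal_pgroup_abelian.
    apply/andP; split; first by rewrite subIset ?sNG.
    by rewrite -{1}defG; apply: mul_subG.
  have [//| eqN] := minnormal_cases nsI (subsetIl _ _).
  by case/negP: nNM; rewrite -eqN subsetIr.
have defP : (P :&: M) * N = P.
  by rewrite group_modr // defG (setIidPl sPG).
have [eqPM | [L maxL sPML]] := maximal_exists (subsetIl P M).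
  by case/negP: nNM; apply: subset_trans sNP _; rewrite -eqPM subsetIr.
have sLP := proper_sub (maxgroupp maxL).
have nPL : ~~ (P \subset L) by have := maxgroupp maxL; rewrite properE => /andP[].
have nNL : ~~ (N \subset L) by apply: contra nPL => sNL; rewrite -defP mul_subG.
have pL := pgroupS sLP pP.
have [[T [sTG defGT ssT]] | tri] := admP L maxL.
  have [hV' _ nV'T] := supplement_Hall pL defGT ssT minp.
  have sV' : p_residual p T \subset N * V by rewrite defR; apply: p_residualS.
  have oV' : #|p_residual p T| = #|V| by rewrite (card_Hall hV') (card_Hall hV).
  have [x Nx defV'] := SchurZassenhaus_trans_sol solN nNV sV' coNV oV'.
  rewrite /= defV' in nV'T; exfalso.
  apply: (no_supplement_over_normaliser pP sPG maxL defGT nV'T (subsetP sNP x Nx)).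
  by apply: subset_trans sPML; rewrite subsetI subsetIl setSI.
have nsLN : L :&: N <| G.
  rewrite /normal subIset ?sNG ?orbT //=.
  apply: (norm_by_Sylow sylP).
    rewrite normsI ?(subset_trans sPG nNG) //.
    exact: normal_norm (p_maximal_normal pP maxL).
  exact: triangle_normI.
have tiLN : L :&: N = 1.
  have [//|eqN] := minnormal_cases nsLN (subsetIr _ _).
  by case/negP: nNL; rewrite -eqN subsetIl.
have oN : #|N| = p.
  rewrite -(p_maximal_index pP maxL) -indexg1 -tiLN setIC indexgI -(indexMg L N).
  congr #|(_ : {set gT}) : _|; apply/eqP; rewrite eqEsubset mul_subG //=.
  by rewrite -{1}defP mulSg.
have cNG : G \subset 'C(N) by apply: (cent_prime_order p_pr oN nNG).
case/negP: nNM; rewrite subsetI sNG cents_norm // centsC.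
by rewrite (subset_trans (subset_trans sVR sRG)).
Qed.

End PCore.

(** * Trivial p-core and p'-core *)

Section TrivialCores.
Variables (gT : finGroupType) (p : nat) (G P : {group gT}).
Implicit Types H K L M N Q R S T X Y A B U V : {group gT}.
Hypotheses (p_pr : prime p) (sylP : p.-Sylow(G) P) (minp : least_prime p G).
Hypotheses (O1 : 'O_p^'(G) = 1) (Op1 : 'O_p(G) = 1).
Hypothesis pn_proper : forall X, P \subset X -> X \proper G -> p_nilpotent p X.
Hypothesis npG : ~~ p_nilpotent p G.

Let sPG : P \subset G := pHall_sub sylP.
Let pP : p.-group P := pHall_pgroup sylP.
Local Notation R := (p_residual_group p G).
Let nsRG : R <| G := p_residual_normal p G.

Lemma normal_p_nilpotent_trivial K : K <| G -> p_nilpotent p K -> K :=: 1.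
Proof.
move=> nsKG /(normal_p_nilpotent_pgroup O1 nsKG) pK.
by apply/trivgP; rewrite -Op1 pcore_max.
Qed.

Lemma p_residual_neq1 : R :!=: 1.
Proof. by apply: contraNneq npG => R1; rewrite /p_nilpotent [p_residual _ _]R1 pgroup1. Qed.

(** Otherwise KP is proper, hence K is p-nilpotent, hence trivial. *)
Lemma p_residual_sub_normal K : K <| G -> K :!=: 1 -> R \subset K.
Proof.
move=> nsKG ntK; have [sKG nKG] := andP nsKG.
have sYG : K <*> P \subset G by rewrite join_subG sKG.
have [eqG | neG] := eqVproper sYG; last first.
  case/eqP: ntK; apply: normal_p_nilpotent_trivial => //.
  by apply: p_nilpotentS (joing_subl K P) (pn_proper _ neG); apply: joing_subr.
apply: p_residual_min => //; rewrite -eqG /= quotientYidl ?(subset_trans sPG) //.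
exact: quotient_pgroup.
Qed.

Lemma not_cyclic_p_residual_Sylow : ~ cyclic (R :&: P).
Proof.
move=> cyc; have sylR : p.-Sylow(R) (R :&: P) by apply: Sylow_setI_normal sylP.
have pnR := cyclic_Sylow_p_nilpotent p_pr sylR cyc (least_primeS (normal_sub nsRG) minp).
by have := p_residual_neq1; rewrite (normal_p_nilpotent_trivial nsRG pnR) eqxx.
Qed.

(** Otherwise the Sylow p-subgroup of O^p(G) would have order at most p. *)
Lemma maximal_meets_p_residual L : maximal L P -> L :&: R != 1.
Proof.
move=> maxL; apply/eqP => tiLR; apply: not_cyclic_p_residual_Sylow.
have : #|(R :&: P)%G| %| p.
  have nsQP : R :&: P <| P.
    by rewrite /normal subsetIr normsI ?normG // (subset_trans sPG) ?normal_norm.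
  have sLP := proper_sub (maxgroupp maxL).
  have tiQL : (R :&: P) :&: L = 1 by rewrite setIAC [R :&: L]setIC tiLR setI1g.
  rewrite -[X in _ %| X](p_maximal_index pP maxL) -indexg1 -tiQL indexgI.
  rewrite -(indexMg L (R :&: P)).
  rewrite -norm_joinEl ?(subset_trans sLP) ?normal_norm //.
  by rewrite indexSg ?joing_subl // join_subG sLP subsetIr.
case/primeP: (p_pr) => _ h /h/orP[] /eqP oQ; last by rewrite prime_cyclic ?oQ.
by rewrite (card1_trivg oQ) cyclic1.
Qed.

(** If SP = G, then O^p(G) = O^p(SP) lies in S. Otherwise SP is p-nilpotent
    and O^p(S) is a p'-group; it equals O^p(SX) for every Sylow p-subgroup X,
    hence is normalised by all of them, hence by G. So it is trivial, S is a
    p-group and lies in O_p(G) = 1. *)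
Lemma embedded_contains_residual S A :
  S_quasinormal S G -> p.-Sylow(S) A -> A \subset P -> A :!=: 1 -> R :&: P \subset A.
Proof.
move=> qnS sylA sAP ntA; have [sSG _] := qnS.
have sYG : S <*> P \subset G by rewrite join_subG sSG.
have [eqG | neG] := eqVproper sYG.
  have sRS : R \subset S.
    by have := p_residual_S_quasinormal qnS p_pr sylP; rewrite eqG.
  suff <- : (S :&: P)%G = A by rewrite /= setSI.
  apply: val_inj; apply: (sub_pHall sylA); rewrite ?subsetIl //.
    by apply: pgroupS (subsetIr _ _) pP.
  by rewrite subsetI (pHall_sub sylA).
have pnS : p_nilpotent p S.
  by apply: p_nilpotentS (joing_subl S P) (pn_proper _ neG); apply: joing_subr.
set D := p_residual_group p S.
(* O^p(S) does not depend on which Sylow p-subgroup S is multiplied by. *)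
have nDP X : p.-Sylow(G) X -> X \subset 'N(D).
  move=> sylX; suff -> : D = p_residual_group p (S <*> X).
    by apply: (subset_trans (joing_subr S X)); rewrite normal_norm ?p_residual_normal.
  apply: val_inj; apply/eqP; rewrite eqEsubset /= p_residualS ?joing_subl //=.
  rewrite -[p_residual p (S <*> X)]p_residual_id; apply: p_residualS.
  exact: p_residual_S_quasinormal qnS p_pr sylX.
pose Y := <<class_support P G>>%G.
have nsYG : Y <| G.
  rewrite /normal norms_gen ?class_support_norm // gen_subG.
  by rewrite class_support_sub_norm ?normG.
have sPY : P \subset Y by apply: sub_gen; apply: sub_class_support.
have ntY : Y :!=: 1.
  by apply: contraNneq ntA => Y1; rewrite -subG1 -Y1 (subset_trans sAP).
have nDG : G \subset 'N(D).
  rewrite -(p_residual_mul_Sylow sylP); apply: mul_subG; last exact: nDP.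
  apply: subset_trans (p_residual_sub_normal nsYG ntY) _.
  rewrite gen_subG class_supportEr; apply/bigcupsP=> x Gx.
  by apply: (nDP (P :^ x)%G); rewrite pHallJ.
have D1 : p_residual p S = 1.
  apply/trivgP; rewrite -O1; apply: pcore_max => //.
  by rewrite /normal (subset_trans (p_residual_sub p S)).
have pS : p.-group S := p_residual1_pgroup D1.
case/eqP: ntA; apply/trivgP; rewrite -Op1.
exact: subset_trans (pHall_sub sylA) (S_quasinormal_pgroup p_pr pS qnS).
Qed.

(** After Kegel and Wielandt. Fix a prime q other than p and choose X maximal
    among the subgroups that have B as a Sylow p-subgroup and permute with
    every Sylow q-subgroup. If b lies in such a Q, the join of X and its
    conjugate by b stays inside XQ, so it still has B as a Sylow p-subgroup;
    by maximality b normalises X. So O^p(G), which lies in the normal closure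
    of Q, normalises X, and the conjugates under P of [X :&: R] all contain B.
    Their intersection is normal in G, so X contains R. *)
Lemma permuting_contains_residual B :
  B \subset P -> B \subset R -> P \subset 'N(B) -> B :!=: 1 ->
  (forall q Q, prime q -> q != p -> q.-Sylow(G) Q -> commute (B : {set gT}) Q) ->
  R :&: P \subset B.
Proof.
move=> sBP sBR nBP ntB cB.
have pB := pgroupS sBP pP.
have [q /andP[q_pr nqp] qG] : exists2 q, prime q && (q != p) & q %| #|G|.
  have : ~~ p.-group G.
    by apply: contra ntB => pG; rewrite -subG1 -Op1 pcore_pgroup_id // (subset_trans sBP).
  move/negP=> h; apply: contrapT => h'; apply/h/pgroupP => q q_pr qG.
  by rewrite inE; apply/negPn/negP => nqp; apply: h'; exists q; rewrite ?q_pr.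
pose permuting_over X := [&& X \subset G, p.-Sylow(X) B &
   [forall Q : {group gT}, q.-Sylow(G) Q ==> (X * Q == Q * X)]].
have gB : permuting_over B.
  rewrite /permuting_over (subset_trans sBP) //= /pHall subxx pB indexgg /=.
  by apply/forall_inP=> Q sylQ; apply/eqP; apply: (cB q).
have [X /maxgroupP[/and3P[sXG sylB /forall_inP cX] maxX] sBX] := maxgroup_exists gB.
have nXQ Q : q.-Sylow(G) Q -> Q \subset 'N(X).
  move=> sylQ; have [sQG qQ _] := and3P sylQ; apply/subsetP=> b Qb.
  have Gb := subsetP sQG b Qb.
  pose Z := (X <*> (X :^ b)%G)%G.
  have sZ : Z \subset X <*> Q.
    rewrite join_subG joing_subl /= -(conjGid (x := b) (G := (X <*> Q)%G)).
      by rewrite conjSg joing_subl.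
    by apply: (subsetP (joing_subr X Q)).
  have sZG : Z \subset G by rewrite join_subG sXG conj_subG.
  have sXZ : X \subset Z by apply: joing_subl.
  have gZ : permuting_over Z.
    rewrite /permuting_over sZG /=; apply/andP; split.
      have sylXQ : p.-Sylow(X <*> Q) B.
        rewrite /pHall (subset_trans sBX) ?joing_subl // pB /=.
        rewrite -(Lagrange_index (joing_subl X Q) sBX) pnatM.
        case/and3P: sylB => _ _ ->; rewrite andbT.
        by apply: pi_p'nat (pnat_index_comm (eqP (cX Q sylQ)) qQ) _; rewrite !inE eq_sym.
      by apply: pHall_subl sylXQ => //; apply: subset_trans sXZ.
    apply/forall_inP=> Q1 sylQ1; apply/eqP.
    have cXb : commute (X :^ b) Q1.
      have sylQ1b : q.-Sylow(G) (Q1 :^ b^-1)%G by rewrite pHallJ ?groupV.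
      have := eqP (cX _ sylQ1b); move/(congr1 (fun A : {set gT} => A :^ b)).
      by rewrite !conjsMg /= conjsgKV.
    exact: comm_joing (eqP (cX _ sylQ1)) cXb.
  by rewrite inE -{2}(maxX Z gZ sXZ) joing_subr.
have [Q sylQ] := Sylow_exists q G.
pose Y := <<class_support Q G>>%G.
have nsYG : Y <| G.
  rewrite /normal norms_gen ?class_support_norm // gen_subG.
  by rewrite class_support_sub_norm ?normG ?(pHall_sub sylQ).
have sQY : Q \subset Y by apply: sub_gen; apply: sub_class_support.
have ntY : Y :!=: 1.
  apply: contraL qG => /eqP Y1.
  rewrite -p'natE // -partn_eq1 // -(card_Hall sylQ).
  by rewrite (_ : Q :=: 1) ?cards1 //; apply/trivgP; rewrite -Y1.
have nXR : R \subset 'N(X).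
  apply: subset_trans (p_residual_sub_normal nsYG ntY) _.
  rewrite gen_subG class_supportEr; apply/bigcupsP=> x Gx.
  by apply: (nXQ (Q :^ x)%G); rewrite pHallJ.
pose C := gcore (X :&: R) G.
have sBC : B \subset C.
  apply/bigcapsP=> g Gg.
  have /mulsgP[r y Rr Py def_g] : g \in p_residual p G * P.
    by rewrite (p_residual_mul_Sylow sylP).
  have nI : R \subset 'N(X :&: R) by rewrite normsI ?normG.
  rewrite def_g conjsgM (normsP nI) // -{1}(normsP nBP y Py) conjSg subsetI sBR.
  by rewrite (pHall_sub sylB).
have nsCG : C <| G by rewrite gcore_normal // subIset ?sXG.
have ntC : C != 1.
  by apply: contraNneq ntB => C1; rewrite -subG1 -C1.
have sRX : R \subset X.
  apply: subset_trans (p_residual_sub_normal nsCG ntC) _.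
  exact: subset_trans (gcore_sub _ _) (subsetIl _ _).
have pRP : p.-group (R :&: P) by apply: pgroupS (subsetIr _ _) pP.
have sBRP : B \subset (R :&: P)%G by rewrite subsetI sBR.
have sRPX : (R :&: P)%G \subset X by rewrite subIset ?sRX.
by rewrite -(sub_pHall sylB pRP sBRP sRPX).
Qed.

(** As K contains R, the trace of L on R lies in the core of L. A nontrivial
    generator of the first core already contains [R :&: P]; for the second
    core, the trace itself permutes with the Sylow q-subgroups, all of which
    lie in R. *)
Lemma triangle_contains_residual L : maximal L P -> triangle L G -> R :&: P \subset L.
Proof.
move=> maxL tri; have sLP := proper_sub (maxgroupp maxL).
have ntLR := maximal_meets_p_residual maxL.
have pL := pgroupS sLP pP; have sLG := subset_trans sLP sPG.
have K1 K : K :=: 1 -> S_quasinormal (L * K) G -> R :&: P \subset L.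
  move=> ->; rewrite mulg1 => qnL; case/negP: ntLR.
  rewrite -subG1; apply: subset_trans (subsetIl _ _) _.
  by rewrite -Op1 S_quasinormal_pgroup.
have LR K : K <| G -> K :!=: 1 -> L :&: R \subset L :&: K.
  by move=> nsKG ntK; rewrite setIS // p_residual_sub_normal.
case: tri => -[K [nsKG qn sub]]; have [/K1-> // | ntK] := eqVneq (K : {set gT}) 1.
  have {}sub := subset_trans (LR K nsKG ntK) sub.
  have : ~~ (se_core L G \subset 1%G).
    by apply: contra ntLR => /(subset_trans sub); rewrite subG1.
  rewrite gen_subG => /subsetPn[x /bigcupP[A /andP[sAL /asboolP seA] Ax] ntx].
  have pA := pgroupS sAL pL.
  have [_ [S qnS sylA]] := iffLR (S_embedded_pgroup _ p_pr pA) seA.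
  apply: subset_trans (sAL); apply: embedded_contains_residual qnS sylA _ _.
    exact: subset_trans sAL sLP.
  by apply: contraNneq ntx => A1; rewrite /= -A1.
have {}sub := subset_trans (LR K nsKG ntK) sub.
apply: subset_trans (subsetIl L R); apply: (@permuting_contains_residual (L :&: R)%G) => //.
- by rewrite subIset ?sLP.
- exact: subsetIr.
- have nLP := normal_norm (p_maximal_normal pP maxL).
  by rewrite normsI // (subset_trans sPG (normal_norm nsRG)).
move=> q Q q_pr nqp sylQ.
pose B := <<\bigcup_(A : {group gT} | (A \subset L) && `[< tau_quasinormal A G >]) A>>%G.
have sBL : B \subset L by rewrite gen_subG; apply/bigcupsP=> A /andP[].
have cBQ : commute (B : {set gT}) Q.
  apply: comm_gen_bigcup => A /andP[sAL /asboolP tA].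
  by apply: (tau_commute p_pr O1 _ tA q_pr nqp sylQ); apply: pgroupS sAL pL.
have -> : (L :&: R)%G = (B :&: R)%G.
  by apply/val_inj/eqP; rewrite eqEsubset /= subsetI sub subsetIr setSI.
have sQR : Q \subset R.
  apply/subsetP=> x Qx; apply: mem_p_residual; first exact: subsetP (pHall_sub sylQ) x Qx.
  apply: sub_p_elt (mem_p_elt (pHall_pgroup sylQ) Qx) => t.
  by rewrite !inE => /eqP->.
by apply/comm_group_setP; rewrite /= setIC group_modr // -[B * Q]comm_joingE // groupP.
Qed.

End TrivialCores.

(** Suppose that G is not p-nilpotent. By Tate's theorem some maximal subgroup
    of P does not contain [R :&: P]; it violates (triangle), so it has a
    supersolvable supplement, which provides a supersolvable Hall p'-subgroup
    V of G. A Frattini argument in R gives [P = (R :&: P) * 'N_P(V)], so a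
    maximal subgroup L containing ['N_P(V)] does not contain [R :&: P], and
    has a supplement as well; by conjugacy of the Hall subgroups
    [no_supplement_over_normaliser] applies. *)
Lemma p_nilpotent_of_trivial_cores (gT : finGroupType) (p : nat) (G P : {group gT}) :
  prime p -> p.-Sylow(G) P -> least_prime p G ->
  'O_p^'(G) = 1 -> 'O_p(G) = 1 ->
  (forall X : {group gT}, P \subset X -> X \proper G -> p_nilpotent p X) ->
  (forall L : {group gT}, maximal L P -> admissible L G) -> p_nilpotent p G.
Proof.
move=> p_pr sylP minp O1 Op1 pn_proper admP; apply: contraT => npG.
have [sPG pP _] := and3P sylP.
set R := p_residual_group p G; have nsRG : R <| G := p_residual_normal p G.
have [sRG nRG] := andP nsRG.
have tri_sub := triangle_contains_residual p_pr sylP minp O1 Op1 pn_proper npG.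
have suppl (L : {group gT}) : maximal L P -> ~~ (R :&: P \subset L) ->
    has_supersolvable_supplement L G.
  move=> maxL nRL; have [//|tri] := admP L maxL.
  by case/negP: nRL; apply: tri_sub.
have [L0 maxL0 nRL0] : exists2 L : {group gT}, maximal L P & ~~ (R :&: P \subset L).
  apply: contrapT => h; case/negP: npG; apply: (Tate_p_nilpotent p_pr sylP).
  apply/bigcapsP=> L /predU1P[-> | maxL]; first exact: subsetIl.
  by rewrite setIC; apply: contrapT => /negP nRL; apply: h; exists L.
have maxp (L : {group gT}) : maximal L P -> p.-group L.
  by move=> maxL; apply: pgroupS pP; apply: proper_sub (maxgroupp maxL).
have hallR (V : {group gT}) : p^'.-Hall(G) V -> p^'.-Hall(R) V.
  move=> hV; have [sVG p'V _] := and3P hV; apply: pHall_subl hV => //.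
  by apply/subsetP=> x Vx; rewrite mem_p_residual ?(subsetP sVG) ?(mem_p_elt p'V).
have [T0 [sT0G defG0 ssT0]] := suppl L0 maxL0 nRL0.
have [hV ssV _] := supplement_Hall (maxp _ maxL0) defG0 ssT0 minp.
set V := p_residual_group p T0 in hV ssV.
have [sVG p'V _] := and3P hV.
have defVP : V * P = G.
  apply/eqP; rewrite eqEcard mul_subG //= coprime_cardMg.
    by rewrite (card_Hall hV) (card_Hall sylP) mulnC partnC ?cardG_gt0.
  by rewrite coprime_sym (pnat_coprime pP p'V).
have defRN : R * 'N_G(V) = G.
  apply/eqP; rewrite eqEsubset mul_subG ?subsetIl //=; apply/subsetP=> g Gg.
  have hVg : p^'.-Hall(R) (V :^ g)%G by apply: hallR; rewrite pHallJ.
  have [r Rr defVg] :=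
    Hall_supersolvable_conj (hallR V hV) hVg ssV (supersolvable_conj g ssV).
  have Gr := subsetP sRG r Rr.
  have Ngr : g * r^-1 \in 'N_G(V).
    by rewrite inE groupM ?groupV //=; apply/normP; rewrite conjsgM defVg conjsgK.
  rewrite -(mulgKV r g) -(normC (subset_trans (subsetIl G 'N(V)) nRG)).
  exact: mem_mulg.
have defN : V * 'N_P(V) = 'N_G(V).
  by rewrite group_modl ?normG // defVP.
have defP : (R :&: P) * 'N_P(V) = P.
  have sVR : V \subset R := pHall_sub (hallR V hV).
  have defG : R * 'N_P(V) = G by rewrite -[RHS]defRN -defN mulgA (mulGSid sVR).
  by rewrite setIC group_modr ?subsetIl // defG (setIidPl sPG).
have [eqP1 | [L maxL sNL]] := maximal_exists (subsetIl P 'N(V)).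
  case/negP: npG; apply: (p_nilpotent_Hall hV); rewrite /normal sVG -defVP mul_subG ?normG //.
  by rewrite -eqP1 subsetIr.
have nPL : ~~ (P \subset L) by have := maxgroupp maxL; rewrite properE => /andP[].
have nRL : ~~ (R :&: P \subset L) by apply: contra nPL => sRL; rewrite -defP mul_subG.
have [T [sTG defGT ssT]] := suppl L maxL nRL.
have [hW ssW nWT] := supplement_Hall (maxp _ maxL) defGT ssT minp.
have [g Gg defW] := Hall_supersolvable_conj hV hW ssV ssW.
move: Gg; rewrite -defVP => /mulsgP[v x Vv Px def_g].
rewrite /= defW def_g conjsgM (conjGid Vv) in nWT; exfalso.
exact: (no_supplement_over_normaliser pP sPG maxL defGT nWT Px sNL).
Qed.

(** * Sylow towers *)

(** In a minimal counterexample O_p'(G) = 1. If O_p(G) = 1 the previous lemma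
    applies. Otherwise two distinct minimal normal subgroups, both p-groups,
    would embed G in a product of p-nilpotent quotients; so there is only one
    and [p_nilpotent_of_minnormal] applies. *)
Theorem admissible_Sylow_p_nilpotent (gT : finGroupType) (p : nat) (G P : {group gT}) :
  prime p -> p.-Sylow(G) P -> least_prime p G -> admissible_Sylow P G -> p_nilpotent p G.
Proof.
have [n] := ubnP #|G|; elim: n => // n IHn in gT G P *.
move=> /ltnSE-leGn p_pr sylP minp.
case=> [cycP | admP]; first exact: cyclic_Sylow_p_nilpotent sylP cycP minp.
have [sPG pP _] := and3P sylP.
have gS : admissible_Sylow P G by right.
have pn_quo (N : {group gT}) :
    N <| G -> N :!=: 1 -> sub_or_p' p N P -> p_nilpotent p (G / N).
  move=> nsNG ntN sc; have [sNG nNG] := andP nsNG.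
  apply: (IHn _ _ (P / N)%G) => //.
  - by apply: leq_trans leGn; apply: ltn_quotient.
  - by apply: quotient_pHall => //; apply: subset_trans nNG.
  - by move=> q q_pr qG; apply: minp => //; apply: dvdn_trans qG (dvdn_quotient _ _).
  exact: (admissible_Sylow_quotient p_pr).
have [O1 | ntO] := eqVneq 'O_p^'(G) 1; last first.
  have p'O : p^'.-group 'O_p^'(G) := pcore_pgroup _ _.
  apply: (p_nilpotent_p'quotient (pcore_normal p^' G) p'O); apply: pn_quo ntO _.
    exact: pcore_normal.
  by rewrite /sub_or_p' p'O orbT.
have [Op1 | ntOp] := eqVneq 'O_p(G) 1.
  apply: (p_nilpotent_of_trivial_cores p_pr sylP) => // X sPX ltXG.
  have sXG := proper_sub ltXG; apply: (IHn _ _ P) => //.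
  - by apply: leq_trans leGn; apply: proper_card.
  - exact: pHall_subl sPX sXG sylP.
  - exact: least_primeS minp.
  exact: admissible_Sylow_sub gS.
have [N minN sNO] := minnormal_exists ntOp (normal_norm (pcore_normal p G)).
have pN : p.-group N := pgroupS sNO (pcore_pgroup p G).
have sNG : N \subset G := subset_trans sNO (pcore_sub p G).
have quoN (M : {group gT}) :
    minnormal M G -> p.-group M -> M \subset G -> p_nilpotent p (G / M).
  move=> minM pM sMG; have [ntM nMG] := andP (mingroupp minM).
  have nsMG : M <| G by apply/andP.
  apply: pn_quo => //; rewrite /sub_or_p'.
  by rewrite (subset_trans _ (pcore_sub_Hall sylP)) // pcore_max.
have [uniqN | ] := pselect (forall K : {group gT}, K <| G -> K :!=: 1 -> N \subset K).
  exact: (p_nilpotent_of_minnormal p_pr sylP minN sNG pN O1 (quoN N minN pN sNG)).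
move=> h; apply: contraT => npG; case: h => K nsKG ntK.
apply: contraT => nNK; case/negP: npG.
have [M minM sMK] := minnormal_exists ntK (normal_norm nsKG).
have [ntM nMG] := andP (mingroupp minM).
have sMG := subset_trans sMK (normal_sub nsKG).
have nsMG : M <| G by apply/andP.
have [ntN nNG] := andP (mingroupp minN); have nsNG : N <| G by apply/andP.
have tiMN : M :&: N = 1.
  have nsI : M :&: N <| G by apply: normalI.
  have [//|eqN] := minnormal_cases minN nsI (subsetIr _ _).
  by case/negP: nNK; rewrite -eqN subIset ?sMK.
have pM : p.-group M.
  apply: (normal_p_nilpotent_pgroup O1 nsMG).
  have nNM : M \subset 'N(N) := subset_trans sMG nNG.
  have pnMN : p_nilpotent p (M / N).
    by apply: p_nilpotentS (quoN N minN pN sNG); apply: quotientS.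
  have p'Q : p^'.-group (p_residual p M / N) by rewrite -quotient_p_residual.
  have sDM := p_residual_sub p M.
  have isoD : p_residual_group p M \isog p_residual p M / N.
    apply: quotient_isog; first exact: subset_trans nNM.
    apply/trivgP; have := setSI N sDM; rewrite tiMN setIC; exact.
  by rewrite /p_nilpotent (isog_pgroup _ isoD).
exact: p_nilpotent_quotientI tiMN (quoN M minM pM sMG) (quoN N minN pN sNG).
Qed.

(** For the least prime p the group is p-nilpotent, and its normal
    p-complement, whose Sylow subgroups are Sylow in G, inherits the
    hypothesis. *)
Theorem admissible_Sylow_normal (gT : finGroupType) (G Q : {group gT}) (q : nat) :
  (forall p (P : {group gT}), prime p -> p.-Sylow(G) P -> admissible_Sylow P G) ->
  prime q -> q.-Sylow(G) Q -> (forall r, prime r -> r %| #|G| -> r <= q) -> Q <| G.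
Proof.
have [n] := ubnP #|G|; elim: n => // n IHn in G Q *.
move=> /ltnSE-leGn admG q_pr sylQ maxq; have [sQG qQ _] := and3P sylQ.
have [G1 | ntG] := eqVneq (G : {set gT}) 1.
  by rewrite (_ : Q :=: 1) ?normal1 //; apply/trivgP; rewrite -G1.
pose p := pdiv #|G|; have p_pr : prime p by rewrite pdiv_prime ?cardG_gt1.
have pG : p %| #|G| by apply: pdiv_dvd.
have minp : least_prime p G by move=> r r_pr rG; apply: pdiv_min_dvd; rewrite ?prime_gt1.
have [P sylP] := Sylow_exists p G.
have pnG := admissible_Sylow_p_nilpotent p_pr sylP minp (admG _ _ p_pr sylP).
have nsWG := p_residual_normal p G; set W := p_residual_group p G in nsWG.
have sWG := normal_sub nsWG.
have hW : p^'.-Hall(G) W.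
  rewrite /pHall sWG [p^'.-group _]pnG /= (eq_pnat _ (negnK _)) -card_quotient ?normal_norm //.
  exact: quotient_p_residual_pgroup.
have [qp | nqp] := eqVneq q p.
  have qG : q.-group G.
    by apply/pgroupP=> r r_pr rG; rewrite inE eqn_leq maxq //= qp minp.
  by rewrite (pHall_id sylQ qG).
have p'q : q \in p^' by rewrite !inE.
have sQW : Q \subset W.
  rewrite (sub_normal_Hall hW) //; apply: pi_pgroup qQ p'q.
have sylQW : q.-Sylow(W) Q by apply: pHall_subl sylQ.
have nsQW : Q <| W.
  apply: (IHn W Q) => //.
  - apply: leq_trans leGn; apply: proper_card; rewrite properE sWG /=.
    apply/negP => /pgroupS/(_ pnG)/pgroupP/(_ p p_pr pG).
    by rewrite !inE eqxx.
  - move=> r S r_pr sylS; have [rp | nrp] := eqVneq r p.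
      left; rewrite rp in sylS.
      have p'S := pgroupS (pHall_sub sylS) pnG.
      by rewrite (card1_trivg (pnat_1 (pHall_pgroup sylS) p'S)) cyclic1.
    apply: admissible_Sylow_sub (pHall_sub sylS) sWG (admG r S r_pr _).
    by apply: subHall_Sylow hW _ sylS; rewrite !inE.
  by move=> r r_pr rW; apply: maxq => //; apply: dvdn_trans rW (cardSg sWG).
by rewrite -(normal_Hall_pcore sylQW nsQW) gFnormal_trans.
Qed.

(** * Saturated formations *)

Lemma supersolvable_cyclic_ext (gT : finGroupType) (G N : {group gT}) :
  N <| G -> cyclic N -> cyclic (G / N) -> supersolvable G.
Proof.
move=> nsNG cN cQ; exists [:: N; G] => //=.
by rewrite sub1G nsNG (normal_sub nsNG) normal_refl cQ -(isog_cyclic (quotient1_isog N)) cN.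
Qed.

Lemma Frattini_complement (gT : finGroupType) (G N : {group gT}) :
  N <| G -> ~~ (N \subset 'Phi(G)) ->
  exists M : {group gT}, [/\ maximal M G, ~~ (N \subset M) & N * M = G].
Proof.
move=> nsNG nPhi.
have /existsP[M /andP[maxM nNM]] :
    [exists M : {group gT}, maximal_eq M G && ~~ (N \subset M)].
  apply: contraR nPhi => /existsPn h; apply/bigcapsP => M maxM.
  by have := h M; rewrite maxM negbK.
exists M; have {}maxM : maximal M G.
  case/predU1P: maxM => // eqM.
  by case/negP: nNM; rewrite eqM normal_sub.
split=> //; have [sNG nNG] := andP nsNG; have [ltMG maxM'] := maxgroupP maxM.
have sMG := proper_sub ltMG.
rewrite -norm_joinEr ?(subset_trans sMG) //; apply/eqP.
have sYG : N <*> M \subset G by rewrite join_subG sNG.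
have [//|ltYG] := eqVproper sYG; first by move=> ->.
by case/negP: nNM; rewrite -(maxM' (N <*> M)%G ltYG) ?joing_subl ?joing_subr.
Qed.

Section Formation.

Variable F : group_class.
Hypotheses (F_formation : formation F) (F_saturated : saturated F).
Hypothesis F_supersolvable :
  forall (rT : finGroupType) (K : {group rT}), supersolvable K -> F K.

Lemma formation_isog (gT rT : finGroupType) (G : {group gT}) (H : {group rT}) :
  G \isog H -> F G -> F H.
Proof. by case: F_formation => iso _ _; apply: iso. Qed.

Lemma formation_quotient (gT : finGroupType) (G N : {group gT}) :
  N <| G -> F G -> F (G / N)%G.
Proof. by case: F_formation => _ quo _; apply: quo. Qed.

Lemma formation_quotient1 (gT : finGroupType) (G : {group gT}) : F (G / 1)%G <-> F G.
Proof.
by split; apply: formation_isog; rewrite ?quotient1_isog // isog_sym quotient1_isog.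
Qed.

Lemma formation_subdirect (gT : finGroupType) (G M N : {group gT}) :
  M <| G -> N <| G -> M :&: N = 1 -> F (G / M)%G -> F (G / N)%G -> F G.
Proof.
move=> nsM nsN ti FM FN; apply/formation_quotient1.
have <- : (M :&: N)%G = 1%G by apply: val_inj.
by case: F_formation => _ _ sub; apply: sub.
Qed.

Lemma formation_third_isog (gT : finGroupType) (G M N : {group gT}) :
  M <| G -> N <| G -> N \subset M -> F (G / N / (M / N))%G <-> F (G / M)%G.
Proof.
move=> nsM nsN sNM; have iso := third_isog sNM nsN nsM.
by split; apply: formation_isog; rewrite // isog_sym.
Qed.

Lemma formation_Frattini (gT : finGroupType) (G N : {group gT}) :
  N <| G -> N \subset 'Phi(G) -> F (G / N)%G -> F G.
Proof.
move=> nsN sNPhi FN; apply: F_saturated; have nsPhi := Phi_normal G.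
apply/(formation_third_isog nsPhi nsN sNPhi); apply: formation_quotient => //.
exact: quotient_normal.
Qed.

(** If N is not in the Frattini subgroup it has a complement M, and
    [C = 'C_M(N)] is normal in G with [N :&: C = 1]; the quotient [G / C] is
    an extension of a cyclic group by a group of automorphisms of N, which is
    cyclic too, so it is supersolvable. Thus G is a subdirect product of two members
    of F. *)
Lemma formation_prime_normal (gT : finGroupType) (G N : {group gT}) :
  N <| G -> prime #|N| -> F (G / N)%G -> F G.
Proof.
move=> nsNG N_pr FN; have [sNG nNG] := andP nsNG.
have [sPhi | nPhi] := boolP (N \subset 'Phi(G)); first exact: formation_Frattini FN.
have [M [maxM nNM defG]] := Frattini_complement nsNG nPhi.
have sMG := proper_sub (maxgroupp maxM); have nNM' := subset_trans sMG nNG.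
pose C := 'C_M(N)%G.
have cycMC : cyclic (M / C).
  rewrite /= -(ker_conj_aut N) (isog_cyclic (first_isog_loc _ _)) //.
  by apply: cyclicS (Aut_conj_aut _ _) _; apply: Aut_prime_cyclic.
have nsCG : C <| G.
  apply/andP; split; first exact: subset_trans (subsetIl _ _) sMG.
  rewrite -defG; apply: mul_subG; last by rewrite normsI ?normG ?norms_cent.
  by rewrite cents_norm // centsC subsetIr.
have tiNC : N :&: C = 1.
  by apply/trivgP; rewrite -(prime_TIg N_pr nNM) setIS ?subsetIl.
apply: (formation_subdirect nsNG nsCG tiNC FN); apply: F_supersolvable.
have nCG := normal_norm nsCG.
apply: (@supersolvable_cyclic_ext _ _ (N / C)%G).
- exact: quotient_normal.
- by apply: quotient_cyclic; apply: prime_cyclic.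
rewrite /= -{1}defG quotientMl ?(subset_trans sNG) // quotientMidl.
exact: quotient_cyclic.
Qed.

(** A minimal counterexample has P minimal normal, not of prime order and not
    in the Frattini subgroup: a complement M of a minimal normal N inside P is
    maximal, [P :&: M] is normal in G as normalisers grow in P, and two
    distinct minimal normal subgroups make G subdirect. Choose L maximal in P
    and normal in a Sylow p-subgroup of G. A supersolvable supplement of L
    contains P, so it is G. If L satisfies (triangle), then it is normalised
    by all Sylow subgroups of G, so it is trivial and P has prime order. *)
Lemma formation_normal_pgroup (gT : finGroupType) (p : nat) (G P : {group gT}) :
  prime p -> P <| G -> p.-group P -> admissible_Sylow P G -> F (G / P)%G -> F G.
Proof.
move=> p_pr; have [n] := ubnP #|G|; elim: n => // n IHn in gT G P *.
move=> /ltnSE-leGn nsPG pP admP FGP; have [sPG nPG] := andP nsPG.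
have [P1 | ntP] := eqVneq (P : {set gT}) 1.
  by apply/formation_quotient1; have <- : P = 1%G by apply: val_inj.
have FGM (M : {group gT}) : minnormal M G -> M \subset P -> F (G / M)%G.
  move=> minM sMP; have [ntM nMG] := andP (mingroupp minM).
  have nsMG : M <| G by rewrite /normal (subset_trans sMP).
  apply: (IHn _ _ (P / M)%G).
  - by apply: leq_trans leGn; apply: ltn_quotient => //; apply: subset_trans sPG.
  - exact: quotient_normal.
  - exact: quotient_pgroup.
  - by apply: (admissible_Sylow_quotient p_pr) => //; rewrite /sub_or_p' sMP.
  exact/(formation_third_isog nsPG nsMG sMP).
have [N minN sNP] := minnormal_exists ntP nPG.
have FGN := FGM N minN sNP; have [ntN nNG] := andP (mingroupp minN).
have sNG := subset_trans sNP sPG; have nsNG : N <| G by apply/andP.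
have pN := pgroupS sNP pP.
have [sPhi | nPhi] := boolP (N \subset 'Phi(G)); first exact: formation_Frattini FGN.
have [M [maxM nNM defG]] := Frattini_complement nsNG nPhi.
have sMG := proper_sub (maxgroupp maxM).
have ltPM : P :&: M \proper P.
  rewrite properE subsetIl subsetI subxx /=.
  by apply: contra nNM; apply: subset_trans.
have nsPM : P :&: M <| G.
  have sMN : M \subset 'N_G(P :&: M).
    by rewrite subsetI sMG normsI ?normG // (subset_trans sMG).
  have [eqN | ltN] := eqVproper (subsetIl G 'N(P :&: M)).
    by rewrite /normal subIset ?sPG //= -{1}eqN subsetIr.
  have [_ maxM'] := maxgroupP maxM.
  have eqM := maxM' 'N_G(P :&: M)%G ltN sMN.
  have := nilpotent_proper_norm (pgroup_nil pP) ltPM.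
  rewrite properE => /andP[_ /negP[]]; rewrite subsetI subsetIl /=.
  by apply: subset_trans (setSI _ sPG) _; rewrite eqM.
have [tiPM | ntPM] := eqVneq (P :&: M) 1; last first.
  have [N2 minN2 sN2] := minnormal_exists ntPM (normal_norm nsPM).
  have sN2P := subset_trans sN2 (subsetIl P M).
  have [ntN2 nN2G] := andP (mingroupp minN2).
  have nsN2G : N2 <| G by rewrite /normal (subset_trans sN2P).
  apply: (formation_subdirect nsNG nsN2G _ FGN (FGM N2 minN2 sN2P)).
  have nsI : N :&: N2 <| G by apply: normalI.
  have [//|eqN] := minnormal_cases minN nsI (subsetIl _ _).
  case/negP: nNM; rewrite -eqN (subset_trans (subsetIr _ _)) //.
  exact: subset_trans sN2 (subsetIr _ _).
have defN : P :=: N.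
  by rewrite -(mulg1 N) -tiPM setIC group_modl // defG (setIidPr sPG).
have {defN} eqPN : P = N by apply: val_inj.
rewrite -{N}eqPN in minN sNP FGN ntN nNG sNG nsNG pN nPhi nNM defG.
have abP : abelian P by apply: (minnormal_pgroup_abelian minN pN).
have caseP (K : {group gT}) : K <| G -> K \subset P -> K :=: 1 \/ K :=: P.
  by move=> nsK sK; apply: (minnormal_cases minN).
have F_order : #|P| = p -> F G.
  by move=> oP'; apply: (formation_prime_normal nsPG); rewrite ?oP'.
have [Gp sylGp] := Sylow_exists p G; have [_ pGp _] := and3P sylGp.
have sPGp : P \subset Gp.
  by apply: subset_trans (pcore_sub_Hall sylGp); apply: pcore_max.
have nsPGp : P <| Gp by apply: normalS nsPG => //; apply: pHall_sub sylGp.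
have [L [sLP nsLGp oL]] := normal_pgroup pGp nsPGp (leq_pred (logn p #|P|)).
have [_ _ [m oP]] := pgroup_pdiv pP ntP.
have iL : #|P : L| = p.
  by rewrite -divgS // oL oP pfactorK //= expnS mulnK ?expn_gt0 ?prime_gt0.
have maxL : maximal L P by apply: p_index_maximal; rewrite ?iL.
have neqLP : L :!=: P.
  by apply: contraTneq (maxgroupp maxL) => ->; rewrite properE subxx.
have F_normal : L <| G -> F G.
  move=> nsLG; have [L1 | eqLP] := caseP L nsLG sLP; last by rewrite eqLP eqxx in neqLP.
  by apply: F_order; rewrite -iL L1 indexg1.
have F_norm : (forall q (Q : {group gT}),
    prime q -> q != p -> q.-Sylow(G) Q -> Q \subset 'N(L)) -> F G.
  move=> nL; apply: F_normal; rewrite /normal (subset_trans sLP) //.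
  exact: norm_by_Sylow sylGp (normal_norm nsLGp) nL.
case: admP => [cycP | /(_ L maxL)[[T [sTG defGT ssT]] | tri]].
- have [_ _ /is_abelemP[q q_pr abP']] := minnormal_solvable minN (subxx P) (pgroup_sol pP).
  apply: F_order; have := cycP; rewrite (abelem_cyclic abP').
  have [qP _ _] := and3P abP'; have [_ qdP _] := pgroup_pdiv qP ntP.
  have eqp : q = p by have /eqnP := pgroupP pP q q_pr qdP.
  by rewrite eqp oP pfactorK // ltnS leqn0 => /eqP->.
- have defP : L * (P :&: T) = P.
    by rewrite setIC group_modl // defGT (setIidPr sPG).
  have nsPT : P :&: T <| G.
    rewrite /normal subIset ?sPG //= -defGT mul_subG //.
      by rewrite (subset_trans sLP) // sub_abelian_norm ?subsetIl.
    by rewrite normsI ?normG // (subset_trans sTG).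
  have [tiPT | eqPT] := caseP (P :&: T)%G nsPT (subsetIl _ _).
    by case/eqP: neqLP; rewrite -[RHS]defP /= tiPT mulg1.
  have sPT : P \subset T by rewrite -eqPT subsetIr.
  have <- : T = G by apply: val_inj; rewrite /= -defGT mulSGid // (subset_trans sLP).
  exact: F_supersolvable.
apply: F_norm => q Q q_pr nqp sylQ; have sQG := pHall_sub sylQ.
have qnI (S : {group gT}) : S_quasinormal S G -> Q \subset 'N(S :&: P).
  move=> qnS; apply: (S_quasinormal_normI nsPG pP qnS q_pr _ sylQ).
  by rewrite !inE.
have q'P : q^'.-group P.
  by apply: pi_p'group pP _; rewrite !inE.
have qn1 (K : {group gT}) :
    K <| G -> K :&: P = 1 -> S_quasinormal (L * K) G -> Q \subset 'N(L).
  move=> nsKG tiKP; have nKL : L \subset 'N(K).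
    by rewrite (subset_trans sLP) // (subset_trans sPG) ?normal_norm.
  rewrite -norm_joinEl // => /qnI; rewrite /= norm_joinEl // -group_modl // tiKP.
  by rewrite mulg1.
have qn2 (R : pred {group gT}) : (forall A, R A -> A \subset L) ->
    (forall A, R A -> Q \subset 'N(A)) ->
    L \subset <<\bigcup_(A : {group gT} | R A) A>> ->
    Q \subset 'N(L).
  move=> RL RQ sLR.
  have -> : (L : {set gT}) = <<\bigcup_(A : {group gT} | R A) A>>.
    by apply/eqP; rewrite eqEsubset sLR gen_subG; apply/bigcupsP.
  apply: norms_gen; apply/subsetP=> x Qx; rewrite inE; apply/subsetP=> z /imsetP[y].
  case/bigcupP=> A RA Ay {z}->; apply/bigcupP; exists A => //.
  by rewrite memJ_norm // (subsetP (RQ A RA)).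
have subK (K : {group gT}) : K <| G -> K :&: P <> 1 -> L \subset L :&: K.
  move=> nsKG nt; rewrite subsetI subxx (subset_trans sLP) //.
  have nsI : (K :&: P)%G <| G by apply: normalI.
  by have [//|<-] := caseP _ nsI (subsetIr _ _); apply: subsetIl.
case: tri => -[K [nsKG qn sub]]; have [tiKP | ntKP] := pselect (K :&: P = 1).
- exact: qn1 qn.
- apply: qn2 (subset_trans (subK K nsKG ntKP) sub) => A /andP[sAL /asboolP seA] //.
  have sAP := subset_trans sAL sLP; have pA := pgroupS sAP pP.
  have [_ [S qnS sylA]] := iffLR (S_embedded_pgroup _ p_pr pA) seA.
  suff <- : S :&: P = A by apply: qnI.
  have sAI : A \subset (S :&: P)%G by rewrite subsetI (pHall_sub sylA).
  exact: (sub_pHall sylA (pgroupS (subsetIr _ _) pP) sAI (subsetIl _ _)).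
- exact: qn1 qn.
apply: qn2 (subset_trans (subK K nsKG ntKP) sub) => A /andP[sAL /asboolP [sAG tauA]] //.
have sAP := subset_trans sAL sLP; have pA := pgroupS sAP pP.
have [A1 | ntA] := eqVneq (A : {set gT}) 1; first by rewrite A1 norms1.
have [_ pdA _] := pgroup_pdiv pA ntA.
have coq : coprime q #|A|.
  rewrite (@pnat_coprime q) ?pnat_id //.
  by apply: pi_p'group pA _; rewrite !inE.
pose Y := <<class_support Q G>>%G.
have nsYG : Y <| G.
  rewrite /normal norms_gen ?class_support_norm // gen_subG.
  by rewrite class_support_sub_norm ?normG.
have sQY : Q \subset Y by apply: sub_gen; apply: sub_class_support.
have [co | nco] := boolP (coprime #|A| #|Y|).
  have nsI : (Y :&: P)%G <| G by apply: normalI.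
  have tiYP : Y :&: P = 1.
    have [//|eqI] := caseP _ nsI (subsetIr _ _).
    have sPY : P \subset Y by rewrite -eqI subsetIl.
    have : p %| gcdn #|A| #|Y|.
      by rewrite dvdn_gcd pdA (dvdn_trans pdA) // cardSg // (subset_trans sAP).
    by rewrite (eqP co) dvdn1 => /eqP p1; have := p_pr; rewrite p1.
  have cYP : Y \subset 'C(P).
    apply/commG1P/trivgP; rewrite -tiYP subsetI commg_subl commg_subr.
    by rewrite (subset_trans sPG (normal_norm nsYG)) (subset_trans (normal_sub nsYG)).
  apply: cents_norm; rewrite (subset_trans sQY) // (subset_trans cYP) //.
  exact: centS.
have cAQ := tauA q Q q_pr sylQ coq nco.
rewrite -(setIidPl sAP); apply: comm_normI cAQ (pHall_pgroup sylQ) q'P _ _.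
  exact: subset_trans sAG nPG.
exact: subset_trans sQG nPG.
Qed.

(** The Sylow subgroup Q of H for the largest prime is normal in G; apply
    induction to [G / Q] and then [formation_normal_pgroup] to Q. *)
Theorem formation_of_admissible_normal (gT : finGroupType) (G H : {group gT}) :
  H <| G -> F (G / H)%G ->
  (forall p (P : {group gT}), prime p -> p.-Sylow(H) P -> admissible_Sylow P G) -> F G.
Proof.
have [n] := ubnP #|G|; elim: n => // n IHn in gT G H *.
move=> /ltnSE-leGn nsHG FGH admH; have [sHG nHG] := andP nsHG.
have [H1 | ntH] := eqVneq (H : {set gT}) 1.
  by apply/formation_quotient1; have <- : H = 1%G by apply: val_inj.
have gt1 : 1 < #|H| by rewrite cardG_gt1.
pose q := max_pdiv #|H|; have q_pr : prime q by rewrite max_pdiv_prime.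
have [Q sylQ] := Sylow_exists q H; have [sQH qQ _] := and3P sylQ.
have nsQH : Q <| H.
  apply: (admissible_Sylow_normal _ q_pr sylQ) => [p P p_pr sylP | r r_pr rH].
    by apply: admissible_Sylow_sub (pHall_sub sylP) sHG _; apply: admH sylP.
  exact: dvdn_le_max_pdiv.
have nsQG : Q <| G.
  by rewrite -(normal_Hall_pcore sylQ nsQH) gFnormal_trans.
have [sQG nQG] := andP nsQG.
apply: (formation_normal_pgroup q_pr nsQG qQ (admH _ _ q_pr sylQ)).
apply: (IHn _ _ (H / Q)%G).
- apply: leq_trans leGn; apply: ltn_quotient => //.
  rewrite -cardG_gt1 (card_Hall sylQ) p_part_gt1 mem_primes q_pr cardG_gt0.
  exact: max_pdiv_dvd.
- exact: quotient_normal.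
- exact/(formation_third_isog nsHG nsQG sQH).
move=> p Pb p_pr sylPb; have nQH := subset_trans sHG nQG.
have [P sylP defPb] := quotient_Sylow_lift nQH p_pr sylPb.
have [sPH pP _] := and3P sylP.
have [pq | npq] := eqVneq p q.
  left; rewrite defPb.
  have sPQ : P \subset Q.
    by rewrite (sub_normal_Hall sylQ nsQH sPH) -pq.
  by rewrite quotientS1 // cyclic1.
have -> : Pb = (P / Q)%G by apply: val_inj.
apply: (admissible_Sylow_quotient p_pr nsQG pP); first exact: subset_trans sPH sHG.
  rewrite /sub_or_p'; apply/orP; right.
  by apply: pi_p'group qQ _; rewrite !inE.
exact: admH sylP.
Qed.

End Formation.

Theorem theorem3p4 (F : group_class)
  (F_formation : formation F) (F_saturated : saturated F)
  (F_supersolvable : forall (rT : finGroupType) (K : {group rT}),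
     supersolvable K -> F rT K)
  (gT : finGroupType) (G : {group gT}) :
  F gT G <->
  exists H : {group gT},
    [/\ H <| G,
        F _ (G / H)%G
      & forall P : {group gT}, Sylow H P -> ~~ cyclic P ->
        forall L : {group gT}, maximal L P ->
          has_supersolvable_supplement L G \/ triangle L G].
Proof.
split=> [FG | [H [nsHG FGH admH]]].
  exists 1%G; split; first exact: normal1.
    exact/(formation_quotient1 F_formation).
  move=> P /SylowP[p _ /pHall_sub/trivgP->].
  by rewrite cyclic1.
apply: (formation_of_admissible_normal F_formation F_saturated F_supersolvable nsHG FGH).
move=> p P p_pr /p_Sylow sylP; have [cP | ncP] := boolP (cyclic P); first by left.
by right=> L maxL; apply: admH maxL.
Qed.
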